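(* There is an absolute constant $C$ such that the following holds for every $n\ge2$. Let $\mathcal{F}$ be a family of $n$ closed discs in the plane, and assign to each $D\in\mathcal{F}$ a list $L_D$ of at least $C\log n$ colors (with no assumption on the relation between different lists). Then one can choose for each $D\in\mathcal{F}$ a color from $L_D$ such that for every closed disc $B$ in the plane for which $S_B=\{D\in\mathcal{F}: D\cap B\neq\emptyset\}$ is nonempty, $S_B$ contains an element whose color differs from the colors of all other elements of $S_B$. The bound $O(\log n)$ on the list size is asymptotically tight. *)

(* Defs.v *)
From Stdlib Require Export Reals List.
Export ListNotations.
Open Scope R_scope.

(* A pdisc in the plane: center (cx, cy) and radius rad.
   A "closed pdisc" is one with rad > 0 (imposed where used). *)
Record pdisc := mkPDisc { cx : R; cy : R; rad : R }.

Definition in_disc (d : pdisc) (p : R * R) : Prop :=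
  (fst p - cx d) ^ 2 + (snd p - cy d) ^ 2 <= rad d ^ 2.

Definition meets (d b : pdisc) : Prop :=
  exists p : R * R, in_disc d p /\ in_disc b p.

Definition conflict_free (n : nat) (D : nat -> pdisc) (col : nat -> nat) : Prop :=
  forall B : pdisc, 0 < rad B ->
    (exists i, (i < n)%nat /\ meets (D i) B) ->
    exists i, (i < n)%nat /\ meets (D i) B /\
      forall j, (j < n)%nat -> j <> i -> meets (D j) B -> col j <> col i.

(* Main.v *)
Require Import Defs.
From Stdlib Require Import Reals List Lra Lia Arith Permutation Sorted Classical.
Open Scope R_scope.

(** Upper bound.  By a potential argument it suffices that every subfamily has a
    coloring with 9 colors in which every disc meeting at least two members meets
    two of different colors; such a coloring follows from degeneracy once
    the pairs [{u, v}] that are exactly the set of members met by some disc are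
    at most four times as many as the members.  If no disc is nested in
    another, a disc [B] is encoded by its topmost point [T] and its radius: [B]
    meets [D] iff [p (T - b) - 2 * rad D <= 2 * rad B], where [b] is the lowest
    point of [D] and [p (s, d) = s^2 / d + d] is subadditive on the upper half
    plane.  In the Voronoi diagram for [p] (this is the picture drawn by Fortune's
    sweep) an exact pair yields a point [T] with [u] and [v] as its two nearest
    sites, and the segments joining the two lowest points to [T] do not cross
    those of any other pair.  Finally a sweep by a horizontal line bounds the
    number of such pairs: the word read along the line changes by inserting a
    block [u...u] or by deleting two adjacent letters [u v].

    Lower bound.  For [n] disjoint discs in a row every interval of consecutive
    discs is cut out by a disc, and a conflict-free coloring of the intervals of
    [2^k] points needs more than [k] colors, by halving. *)

(** * Potential argument for list colorings *)

Definition Rsum {A : Type} (f : A -> R) (l : list A) : R :=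
  fold_right (fun v s => f v + s) 0 l.

Lemma Rsum_app {A : Type} (f : A -> R) (l1 l2 : list A) :
  Rsum f (l1 ++ l2) = Rsum f l1 + Rsum f l2.
Proof. induction l1 as [|a l1 IH]; simpl; [|rewrite IH]; lra. Qed.

Lemma Rsum_perm {A : Type} (f : A -> R) (l1 l2 : list A) :
  Permutation l1 l2 -> Rsum f l1 = Rsum f l2.
Proof. induction 1; simpl; lra. Qed.

Lemma Rsum_le {A : Type} (f g : A -> R) (l : list A) :
  (forall v, In v l -> f v <= g v) -> Rsum f l <= Rsum g l.
Proof.
  induction l as [|a l IH]; simpl; intros H; [lra|].
  specialize (IH (fun v Hv => H v (or_intror Hv))).
  specialize (H a (or_introl eq_refl)). lra.
Qed.

Lemma Rsum_nonneg {A : Type} (f : A -> R) (l : list A) :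
  (forall v, In v l -> 0 <= f v) -> 0 <= Rsum f l.
Proof.
  induction l as [|a l IH]; simpl; intros H; [lra|].
  specialize (IH (fun v Hv => H v (or_intror Hv))).
  specialize (H a (or_introl eq_refl)). lra.
Qed.

Lemma Rsum_scal {A : Type} (c : R) (f : A -> R) (l : list A) :
  Rsum (fun v => c * f v) l = c * Rsum f l.
Proof. induction l as [|a l IH]; simpl; [|rewrite IH]; lra. Qed.

Lemma Rsum_const {A : Type} (c : R) (l : list A) :
  Rsum (fun _ => c) l = INR (length l) * c.
Proof.
  induction l as [|a l IH]; cbn [Rsum fold_right length]; [simpl; lra|].
  fold (Rsum (fun _ : A => c) l). rewrite IH, S_INR. lra.
Qed.

Lemma split_prop {A : Type} (P : A -> Prop) (l : list A) :
  exists l1 l2, Permutation l (l1 ++ l2) /\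
    (forall v, In v l1 -> P v) /\ (forall v, In v l2 -> ~ P v).
Proof.
  induction l as [|a l (l1 & l2 & Hp & H1 & H2)].
  - exists [], []. simpl. split; [constructor|tauto].
  - destruct (classic (P a)) as [Ha|Ha].
    + exists (a :: l1), l2. simpl. split; [now constructor|].
      split; [intros v [<-|Hv]; auto|auto].
    + exists l1, (a :: l2). split; [now apply Permutation_cons_app|].
      split; [auto|]. simpl. intros v [<-|Hv]; auto.
Qed.

Lemma exists_filter {A : Type} (P : A -> Prop) (l : list A) :
  NoDup l -> exists l', NoDup l' /\ forall v, In v l' <-> In v l /\ P v.
Proof.
  intros Hl. destruct (split_prop P l) as (l1 & l2 & Hp & H1 & H2).
  exists l1. split.
  - apply (Permutation_NoDup Hp) in Hl. now apply NoDup_app_remove_r in Hl.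
  - intros v. split.
    + intros Hv. split; [|auto]. apply (Permutation_in _ (Permutation_sym Hp)).
      apply in_or_app; auto.
    + intros [Hv HP]. apply (Permutation_in _ Hp) in Hv.
      apply in_app_or in Hv as [Hv|Hv]; [auto|]. now apply H2 in Hv.
Qed.

(** Pigeonhole by induction on [k]: if the class of the last color has less than its share of the
    sum, the heaviest class among the other [k] colors is heavier than it, and so makes up for it as
    well. *)
Lemma heavy_color_class (f : nat -> R) (chi : nat -> nat) (k : nat) :
  (1 <= k)%nat -> forall l : list nat,
  (forall v, In v l -> 0 <= f v /\ (chi v < k)%nat) ->
  exists j I rest, Permutation l (I ++ rest) /\
    (forall v, In v I -> chi v = j) /\ Rsum f l <= INR k * Rsum f I.
Proof.
  intros Hk. induction Hk as [|k Hk IH]; intros l Hl.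
  - exists 0%nat, l, []. rewrite app_nil_r. split; [auto|]. split.
    + intros v Hv. apply Hl in Hv. lia.
    + simpl. lra.
  - destruct (split_prop (fun v => chi v = k) l) as (I & rest & Hp & H1 & H2).
    destruct (Rle_lt_dec (Rsum f l) (INR (S k) * Rsum f I)) as [Hle|Hlt].
    { exists k, I, rest. auto. }
    destruct (IH rest) as (j & I' & rest' & Hp' & Hj & Hs).
    { intros v Hv. assert (Hin : In v l).
      { apply (Permutation_in _ (Permutation_sym Hp)), in_or_app; auto. }
      apply Hl in Hin. apply H2 in Hv. split; [tauto|lia]. }
    exists j, I', (rest' ++ I). split; [|split; [exact Hj|]].
    + rewrite app_assoc. rewrite <- Hp'. rewrite Hp. apply Permutation_app_comm.
    + rewrite (Rsum_perm f _ _ Hp), Rsum_app in *. rewrite S_INR in *.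
      apply le_INR in Hk. simpl in Hk. nra.
Qed.

(** Hyperedges are predicates on all indices and only their trace on [S] counts, so one [H] serves
    every subfamily. *)
Definition proper_on (H : (nat -> Prop) -> Prop) (S : list nat) (chi : nat -> nat) : Prop :=
  forall e, H e -> forall u v, In u S -> In v S -> u <> v -> e u -> e v ->
  exists u' v', In u' S /\ In v' S /\ e u' /\ e v' /\ chi u' <> chi v'.

Definition available (L : nat -> list nat) (cs : list nat) (v : nat) : nat :=
  length (filter (fun c => if in_dec Nat.eq_dec c (L v) then true else false) cs).

(* Colors are treated one after the other.  Give an uncolored vertex the weight
   [(1 - 1/k) ^ available].  The heaviest class of a proper [k]-coloring of the
   vertices able to use the current color has a [1/k] fraction of their weight,
   so giving it this color does not increase the total weight, which stays below
   [1] and thus excludes an uncolored vertex with no color left.  In a hyperedge,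
   the last color to be used occurs only once. *)
Lemma conflict_free_list_coloring (H : (nat -> Prop) -> Prop) (L : nat -> list nat)
    (V : list nat) (k : nat) :
  (2 <= k)%nat ->
  (forall S, NoDup S -> incl S V ->
     exists chi, (forall v, In v S -> (chi v < k)%nat) /\ proper_on H S chi) ->
  forall cs, NoDup cs -> forall S, NoDup S -> incl S V ->
  Rsum (fun v => (1 - / INR k) ^ available L cs v) S < 1 ->
  exists col : nat -> nat,
    (forall v, In v S -> In (col v) (L v) /\ In (col v) cs) /\
    forall e, H e -> (exists v, In v S /\ e v) ->
      exists v, In v S /\ e v /\ forall u, In u S -> u <> v -> e u -> col u <> col v.
Proof.
  intros Hk Hprop.
  assert (HK : 2 <= INR k) by (apply le_INR in Hk; simpl in Hk; lra).
  set (q := 1 - / INR k).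
  assert (Hinv : / INR k * INR k = 1) by (apply Rinv_l; lra).
  assert (Hq : 0 < q).
  { unfold q. assert (/ INR k <= / 2) by (apply Rinv_le_contravar; lra). lra. }
  induction cs as [|c cs IH]; intros Hcs S HS HSV Hsum.
  - destruct S as [|v S].
    + exists (fun _ => 0%nat). split; [intros v []|]. intros e _ (v & [] & _).
    + exfalso. simpl in Hsum.
      assert (0 <= Rsum (fun _ : nat => 1) S) by (apply Rsum_nonneg; intros; lra).
      unfold Rsum in *. lra.
  - inversion Hcs as [|? ? Hc Hcs']; subst.
    destruct (split_prop (fun v => In c (L v)) S) as (Sc & Sn & Hp & HSc & HSn).
    assert (HinS : forall v, In v S <-> In v Sc \/ In v Sn).
    { intros v. rewrite <- in_app_iff. split; apply Permutation_in; [|symmetry]; auto. }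
    assert (HND := Permutation_NoDup Hp HS).
    destruct (Hprop Sc) as (chi & Hchi & Hpr).
    { now apply NoDup_app_remove_r in HND. }
    { intros v Hv. apply HSV, HinS. auto. }
    set (w := fun v => q ^ available L (c :: cs) v) in *.
    set (w' := fun v => q ^ available L cs v).
    assert (Hw : forall v, 0 < w v) by (intros; apply pow_lt, Hq).
    destruct (heavy_color_class w chi k ltac:(lia) Sc) as (j & I & rest & HpI & HI & Hheavy).
    { intros v Hv. split; [apply Rlt_le, Hw|auto]. }
    assert (HinSc : forall v, In v Sc <-> In v I \/ In v rest).
    { intros v. rewrite <- in_app_iff. split; apply Permutation_in; [|symmetry]; auto. }
    assert (Hp' : Permutation S (I ++ (rest ++ Sn))).
    { rewrite Hp, HpI, app_assoc. reflexivity. }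
    assert (HND' := Permutation_NoDup Hp' HS).
    destruct (IH Hcs' (rest ++ Sn)) as (col & Hcol & HCF).
    { now apply NoDup_app_remove_l in HND'. }
    { intros v Hv. apply HSV, HinS. rewrite in_app_iff in Hv. rewrite HinSc. tauto. }
    { fold w'. rewrite Rsum_app.
      rewrite (Rsum_perm w _ _ Hp), Rsum_app in Hsum.
      (* Vertices of [Sn] keep their weight and those of [rest] gain a factor [1 / q]. Since [I]
         carries a [1 / k] fraction of the weight of [Sc], what is left for [rest] is at most [q]
         times that weight, which absorbs the factor. *)
      assert (E1 : Rsum w' Sn <= Rsum w Sn).
      { apply Rsum_le. intros v Hv. unfold w, w', available. simpl.
        destruct (in_dec Nat.eq_dec c (L v)) as [Hi|Hi]; [now apply HSn in Hv|lra]. }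
      assert (E2 : q * Rsum w' rest <= Rsum w rest).
      { rewrite <- Rsum_scal. apply Rsum_le. intros v Hv. unfold w, w', available. simpl.
        destruct (in_dec Nat.eq_dec c (L v)) as [Hi|Hi]; [simpl; lra|].
        exfalso. apply Hi, HSc, HinSc. auto. }
      rewrite (Rsum_perm w _ _ HpI), Rsum_app in Hsum, Hheavy.
      assert (E3 : Rsum w rest <= q * (Rsum w I + Rsum w rest)).
      { apply (Rmult_le_compat_l (/ INR k)) in Hheavy.
        - rewrite <- Rmult_assoc, Hinv in Hheavy. unfold q. lra.
        - apply Rlt_le, Rinv_0_lt_compat. lra. }
      assert (q * Rsum w' rest <= q * (Rsum w I + Rsum w rest)) as E4 by lra.
      apply Rmult_le_reg_l in E4; [lra|exact Hq]. }
    exists (fun v => if in_dec Nat.eq_dec v I then c else col v).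
    assert (Hout : forall v, In v S -> ~ In v I -> In v (rest ++ Sn)).
    { intros v Hv Hn. apply (Permutation_in _ Hp'), in_app_or in Hv. tauto. }
    assert (HIS : forall v, In v I -> In v S).
    { intros v Hv. apply HinS. left. apply HinSc. auto. }
    assert (HSI : forall v, In v (rest ++ Sn) -> In v S /\ ~ In v I).
    { intros v Hv. split.
      - apply (Permutation_in _ (Permutation_sym Hp')), in_or_app. auto.
      - intros Hn. apply in_split in Hn as (I1 & I2 & ->).
        rewrite <- app_assoc in HND'. simpl in HND'. apply NoDup_remove_2 in HND'.
        apply HND'. rewrite !in_app_iff. apply in_app_or in Hv. tauto. }
    split.
    + intros v Hv. destruct (in_dec Nat.eq_dec v I) as [Hi|Hi].
      * split; [apply HSc, HinSc; auto|left; auto].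
      * destruct (Hcol v (Hout v Hv Hi)). split; [auto|right; auto].
    + intros e He (v0 & Hv0 & Hev0).
      (* If [e] has a vertex colored later, the one with a unique later color stays unique because
         [c] does not occur in [cs]. Otherwise the trace of [e] lies in the single class [I], so by
         properness it is one vertex. *)
      destruct (classic (exists v, In v (rest ++ Sn) /\ e v)) as [Hex|Hnex].
      * destruct (HCF e He Hex) as (v & Hv & Hev & Huniq).
        exists v. destruct (HSI v Hv) as [HvS HvI]. split; [auto|split; [auto|]].
        intros u Hu Huv Heu.
        destruct (in_dec Nat.eq_dec v I) as [?|_]; [tauto|].
        destruct (in_dec Nat.eq_dec u I) as [_|Hn].
        -- intros ->. apply Hc. apply Hcol. auto.
        -- apply Huniq; auto.
      * exists v0. split; [auto|split; [auto|]].
        assert (Hall : forall u, In u S -> e u -> In u I).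
        { intros u Hu Heu. apply NNPP. intros Hn. apply Hnex. exists u. auto. }
        intros u Hu Huv Heu. exfalso.
        destruct (Hpr e He u v0) as (a & b & Ha & Hb & Hea & Heb & Hab); auto.
        -- apply HinSc. auto.
        -- apply HinSc. auto.
        -- apply Hab. rewrite (HI a), (HI b); auto; apply Hall; auto; apply HinS; auto.
Qed.

(* Color the other vertices first, then [v]: the only hyperedges of which [v]
   destroys the properness are the pairs [{u, v}]. *)
Lemma proper_coloring_of_degenerate (H : (nat -> Prop) -> Prop) (V : list nat) (d : nat) :
  (forall S, NoDup S -> incl S V -> S <> [] ->
     exists v N, In v S /\ (length N <= d)%nat /\
       forall u e, In u S -> u <> v -> H e ->
         (forall x, In x S -> (e x <-> x = u \/ x = v)) -> In u N) ->
  forall S, NoDup S -> incl S V ->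
    exists chi, (forall v, In v S -> (chi v < Datatypes.S d)%nat) /\ proper_on H S chi.
Proof.
  intros Hdeg S. remember (length S) as n eqn:Hn. revert S Hn.
  induction n as [|n IH]; intros S Hn HS HSV.
  { destruct S; [|discriminate]. exists (fun _ => 0%nat).
    split; [intros v []|]. intros e _ u v []. }
  destruct (Hdeg S HS HSV) as (v & N & Hv & HN & Hex).
  { intros ->. discriminate. }
  destruct (in_split _ _ Hv) as (S1 & S2 & ->).
  assert (Hin : forall x, In x (S1 ++ v :: S2) <-> x = v \/ In x (S1 ++ S2)).
  { intros x. rewrite !in_app_iff. simpl. intuition. }
  assert (HS' := NoDup_remove _ _ _ HS). destruct HS' as [HS' Hvn].
  destruct (IH (S1 ++ S2)) as (chi & Hchi & Hpr); auto.
  { rewrite length_app in *. simpl in Hn. lia. }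
  { intros x Hx. apply HSV, Hin. auto. }
  assert (Hfree : exists c, (c < Datatypes.S d)%nat /\ ~ In c (map chi N)).
  { apply NNPP. intros Hno.
    assert (Hincl : incl (seq 0 (Datatypes.S d)) (map chi N)).
    { intros c Hc. apply in_seq in Hc. apply NNPP. intros Hcn. apply Hno.
      exists c. split; [lia|auto]. }
    apply NoDup_incl_length in Hincl; [|apply seq_NoDup].
    rewrite length_seq, length_map in Hincl. lia. }
  destruct Hfree as (c & Hcd & HcN).
  set (chi' := fun x => if Nat.eq_dec x v then c else chi x).
  assert (E1 : chi' v = c) by (unfold chi'; destruct (Nat.eq_dec v v); tauto).
  assert (E2 : forall x, x <> v -> chi' x = chi x).
  { intros x Hx. unfold chi'. destruct (Nat.eq_dec x v); tauto. }
  exists chi'. split.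
  { intros x Hx. destruct (Nat.eq_dec x v) as [->|Hxv]; [lia|].
    rewrite E2; auto. apply Hchi. apply Hin in Hx. tauto. }
  intros e He.
  destruct (classic (exists a b, In a (S1 ++ S2) /\ In b (S1 ++ S2) /\ a <> b /\ e a /\ e b))
    as [(a & b & Ha & Hb & Hab & Hea & Heb)|Hno].
  - intros _ _ _ _ _ _ _.
    destruct (Hpr e He a b) as (x & y & Hx & Hy & Hex' & Hey & Hxy); auto.
    exists x, y. rewrite !Hin. rewrite !E2; auto 10; intros ->; auto.
  - assert (Hmain : forall u, In u (S1 ++ v :: S2) -> u <> v -> e u -> e v ->
      exists u' v', In u' (S1 ++ v :: S2) /\ In v' (S1 ++ v :: S2) /\
        e u' /\ e v' /\ chi' u' <> chi' v').
    { intros u Hu Huv Heu Hev. exists u, v. split; [auto|]. split; [auto|].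
      split; [auto|]. split; [auto|]. rewrite E1, E2 by auto.
      intros Hc. apply HcN. rewrite <- Hc. apply in_map. apply (Hex u e); auto.
      intros x Hx. split.
      - intros Hex'. destruct (Nat.eq_dec x v) as [->|Hxv]; [auto|].
        left. apply NNPP. intros Hxu. apply Hno. exists x, u.
        apply Hin in Hx, Hu. tauto.
      - intros [->| ->]; auto. }
    intros u w Hu Hw Huw Heu Hew.
    destruct (Nat.eq_dec u v) as [->|Huv].
    + apply (Hmain w); auto.
    + destruct (Nat.eq_dec w v) as [->|Hwv].
      * apply (Hmain u); auto.
      * exfalso. apply Hno. exists u, w. apply Hin in Hu, Hw. tauto.
Qed.

(** * Crossing-free systems of caps *)

Lemma StronglySorted_app {A : Type} (R : A -> A -> Prop) (l1 l2 : list A) :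
  StronglySorted R (l1 ++ l2) <->
  StronglySorted R l1 /\ StronglySorted R l2 /\
  (forall a b, In a l1 -> In b l2 -> R a b).
Proof.
  induction l1 as [|x l1 IH]; simpl.
  - split; [intros H; repeat split; auto using SSorted_nil; tauto|tauto].
  - split.
    + intros H. apply StronglySorted_inv in H as [H1 H2].
      rewrite Forall_app, !Forall_forall in H2. apply IH in H1 as (H3 & H4 & H5).
      repeat split; auto.
      * constructor; auto. apply Forall_forall. tauto.
      * intros a b [<-|Ha] Hb; [now apply H2|auto].
    + intros (H1 & H2 & H3). apply StronglySorted_inv in H1 as [H1 H4].
      constructor; [apply IH; auto|].
      apply Forall_app. split; [auto|]. apply Forall_forall. auto.
Qed.

Lemma sort_by_key {A : Type} (key : A -> R) (l : list A) :
  NoDup l -> (forall a b, In a l -> In b l -> key a = key b -> a = b) ->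
  exists l', Permutation l l' /\ StronglySorted (fun a b => key a < key b) l'.
Proof.
  induction l as [|x l IH]; intros Hnd Hinj.
  - exists []. split; constructor.
  - inversion Hnd as [|? ? Hx Hnd']; subst.
    destruct IH as (l' & Hp & Hs); auto.
    { intros a b Ha Hb. apply Hinj; now right. }
    assert (Hins : exists l1 l2, l' = l1 ++ l2 /\
      (forall a, In a l1 -> key a < key x) /\ (forall a, In a l2 -> key x < key a)).
    { assert (Hne : forall a, In a l' -> key a <> key x).
      { intros a Ha He. apply (Permutation_in _ (Permutation_sym Hp)) in Ha.
        apply Hinj in He; [subst; auto|now right|now left]. }
      clear - Hs Hne. induction l' as [|y l' IH].
      - exists [], []. simpl. tauto.
      - apply StronglySorted_inv in Hs as [Hs Hy]. rewrite Forall_forall in Hy.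
        destruct (Rlt_le_dec (key y) (key x)) as [Hlt|Hge].
        + destruct IH as (l1 & l2 & -> & H1 & H2); auto.
          { intros a Ha. apply Hne. now right. }
          exists (y :: l1), l2. simpl. repeat split; auto. intros a [<-|Ha]; auto.
        + exists [], (y :: l'). simpl. repeat split; [tauto|].
          assert (key y <> key x) by (apply Hne; now left).
          intros a [<-|Ha]; [lra|]. specialize (Hy a Ha). lra. }
    destruct Hins as (l1 & l2 & -> & H1 & H2).
    apply StronglySorted_app in Hs as (S1 & S2 & S3).
    exists (l1 ++ x :: l2). split; [now apply Permutation_cons_app|].
    apply StronglySorted_app. split; [auto|split].
    + constructor; [auto|]. now apply Forall_forall.
    + intros a b Ha [<-|Hb]; auto.
Qed.

Lemma exists_argmin {A : Type} (f : A -> R) (l : list A) :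
  l <> [] -> exists x, In x l /\ forall y, In y l -> f x <= f y.
Proof.
  induction l as [|a l IH]; [tauto|]. intros _.
  destruct l as [|b l].
  - exists a. simpl. split; [auto|]. intros y [<-|[]]. lra.
  - destruct IH as (x & Hx & Hmin); [discriminate|].
    destruct (Rle_lt_dec (f a) (f x)) as [Hle|Hlt].
    + exists a. split; [now left|]. intros y [<-|Hy]; [lra|].
      specialize (Hmin y Hy). lra.
    + exists x. split; [now right|]. intros y [<-|Hy]; [lra|auto].
Qed.

Lemma sorted_cut {A : Type} (R : A -> A -> Prop) (P : A -> Prop) (l : list A) :
  StronglySorted R l ->
  (forall a b, In a l -> In b l -> R a b -> P b -> P a) ->
  exists l1 l2, l = l1 ++ l2 /\ (forall a, In a l1 -> P a) /\ (forall a, In a l2 -> ~ P a).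
Proof.
  induction l as [|x l IH]; intros Hs Hd.
  - exists [], []. simpl. tauto.
  - apply StronglySorted_inv in Hs as [Hs Hx]. rewrite Forall_forall in Hx.
    destruct (classic (P x)) as [HP|HP].
    + destruct IH as (l1 & l2 & -> & H1 & H2); auto.
      { intros a b Ha Hb. apply Hd; now right. }
      exists (x :: l1), l2. simpl. repeat split; auto. intros a [<-|Ha]; auto.
    + exists [], (x :: l). simpl. repeat split; [tauto|].
      intros a [<-|Ha]; [auto|]. intros HPa. apply HP.
      apply (Hd x a); [now left|now right|auto|auto].
Qed.

(** * Costs of words *)

Definition pair_eq_dec : forall e e' : nat * nat, {e = e'} + {e <> e'}.
Proof. decide equality; apply Nat.eq_dec. Defined.

Definition is_edge (E : list (nat * nat)) (u v : nat) : Prop := In (u, v) E \/ In (v, u) E.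

(* [E] lists the edges still to be completed; a boundary between two runs of
   letters can absorb one edge if its pair is still in [E], and pays one unit in
   any case when it disappears. *)
Definition cost (E : list (nat * nat)) (u v : nat) : nat :=
  if Nat.eq_dec u v then 0%nat
  else if in_dec pair_eq_dec (u, v) E then 2%nat
  else if in_dec pair_eq_dec (v, u) E then 2%nat else 1%nat.

Fixpoint word_cost (E : list (nat * nat)) (w : list nat) : nat :=
  match w with
  | [] => 0
  | u :: w' => match w' with [] => 0 | v :: _ => cost E u v end + word_cost E w'
  end%nat.

Lemma cost_diag E u : cost E u u = 0%nat.
Proof. unfold cost. destruct (Nat.eq_dec u u); tauto. Qed.

Lemma cost_le_2 E u v : (cost E u v <= 2)%nat.
Proof. unfold cost. repeat destruct (_ : {_} + {_}); lia. Qed.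

Lemma cost_pos E u v : u <> v -> (1 <= cost E u v)%nat.
Proof.
  intros H. unfold cost. destruct (Nat.eq_dec u v); [tauto|].
  repeat destruct (_ : {_} + {_}); lia.
Qed.

Lemma cost_mono E E' u v : incl E' E -> (cost E' u v <= cost E u v)%nat.
Proof.
  intros H. unfold cost. destruct (Nat.eq_dec u v); [lia|].
  destruct (in_dec pair_eq_dec (u, v) E') as [H1|H1].
  { destruct (in_dec pair_eq_dec (u, v) E) as [|Hn]; [lia|destruct Hn; auto]. }
  destruct (in_dec pair_eq_dec (v, u) E') as [H2|H2].
  { destruct (in_dec pair_eq_dec (u, v) E); [lia|].
    destruct (in_dec pair_eq_dec (v, u) E) as [|Hn]; [lia|destruct Hn; auto]. }
  repeat destruct (_ : {_} + {_}); lia.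
Qed.

Lemma cost_edge E u v : u <> v -> is_edge E u v -> cost E u v = 2%nat.
Proof.
  intros Hne H. unfold cost. destruct (Nat.eq_dec u v); [tauto|].
  destruct (in_dec pair_eq_dec (u, v) E); [lia|].
  destruct (in_dec pair_eq_dec (v, u) E); [lia|]. destruct H; tauto.
Qed.

Lemma cost_nonedge E u v : ~ is_edge E u v -> (cost E u v <= 1)%nat.
Proof.
  intros H. unfold cost. destruct (Nat.eq_dec u v); [lia|].
  destruct (in_dec pair_eq_dec (u, v) E); [destruct H; now left|].
  destruct (in_dec pair_eq_dec (v, u) E); [destruct H; now right|lia].
Qed.

Lemma word_cost_mono E E' w : incl E' E -> (word_cost E' w <= word_cost E w)%nat.
Proof.
  intros H. induction w as [|u w IH]; [simpl; lia|].
  destruct w as [|v w]; [simpl; lia|].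
  cbn [word_cost] in *. pose proof (cost_mono E E' u v H). lia.
Qed.

(** The boundary [u v] pays 2, and its neighbors [x u] and [v z] merge into [x z], which costs at
    most 2. If [x <> u] or [z <> v], one of these neighbors pays the missing unit; otherwise [x z]
    is the pair [u v] itself, now outside [E'], and costs at most 1. *)
Lemma word_cost_cancel E E' l1 u v l2 :
  incl E' E -> u <> v -> is_edge E u v -> ~ is_edge E' u v ->
  (word_cost E' (l1 ++ l2) + 1 <= word_cost E (l1 ++ u :: v :: l2))%nat.
Proof.
  intros Hi Hne He He'. pose proof (cost_edge E u v Hne He) as Huv.
  induction l1 as [|x l1 IH].
  - pose proof (word_cost_mono E E' l2 Hi). cbn [app word_cost]. lia.
  - destruct l1 as [|y l1].
    + destruct l2 as [|z l2]; cbn [app word_cost] in *; [lia|].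
      pose proof (word_cost_mono E E' (z :: l2) Hi) as Hm. cbn [word_cost] in Hm.
      enough (cost E' x z + 1 <= cost E x u + cost E u v + cost E v z)%nat by lia.
      rewrite Huv. pose proof (cost_le_2 E' x z).
      destruct (Nat.eq_dec x u) as [->|Hxu].
      * destruct (Nat.eq_dec z v) as [->|Hzv].
        -- pose proof (cost_nonedge E' u v He'). lia.
        -- assert (1 <= cost E v z)%nat by (apply cost_pos; auto). lia.
      * assert (1 <= cost E x u)%nat by (apply cost_pos; auto). lia.
    + cbn [app word_cost] in *. pose proof (cost_mono E E' x y Hi). lia.
Qed.

Lemma word_cost_cons_same E u w : word_cost E (u :: u :: w) = word_cost E (u :: w).
Proof. cbn [word_cost]. rewrite cost_diag. reflexivity. Qed.

(** The block is a single run, so it creates at most two new boundaries, each of cost at most 2. *)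
Lemma word_cost_insert E l1 B l2 u :
  (forall x, In x B -> x = u) ->
  (word_cost E (l1 ++ B ++ l2) <= word_cost E (l1 ++ l2) + 4)%nat.
Proof.
  intros HB. destruct B as [|b B]; [simpl; lia|].
  assert (Hred : forall w, word_cost E (u :: B ++ w) = word_cost E (u :: w)).
  { assert (HB' : forall x, In x B -> x = u) by (intros; apply HB; now right).
    clear HB. induction B as [|c B IH]; intros w; [reflexivity|].
    rewrite (HB' c (or_introl eq_refl)). cbn [app].
    rewrite word_cost_cons_same. apply IH. intros; apply HB'; now right. }
  rewrite (HB b (or_introl eq_refl)). clear HB b. cbn [app].
  induction l1 as [|x l1 IH]; cbn [app].
  - rewrite Hred. destruct l2 as [|z l2]; cbn [word_cost]; [lia|].
    pose proof (cost_le_2 E u z). lia.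
  - destruct l1 as [|y l1].
    + cbn [app]. change (cost E x u + word_cost E (u :: B ++ l2) <=
        word_cost E (x :: l2) + 4)%nat.
      rewrite Hred. pose proof (cost_le_2 E x u).
      destruct l2 as [|z l2]; cbn [word_cost]; [lia|].
      pose proof (cost_le_2 E u z). lia.
    + cbn [app word_cost] in *. lia.
Qed.

(** * Affine arms and systems of caps *)

Lemma affine_crossing (a s b r h0 h1 : R) :
  h0 < h1 -> a + s * h0 < b + r * h0 -> b + r * h1 <= a + s * h1 ->
  exists h, h0 < h <= h1 /\ a + s * h = b + r * h.
Proof.
  intros H01 H0 H1. assert (Hsr : 0 < s - r) by nra.
  exists ((b - a) / (s - r)).
  assert (E : (b - a) / (s - r) * (s - r) = b - a) by (field; lra).
  set (h := (b - a) / (s - r)) in *. split; [split|]; nra.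
Qed.

Lemma affine_le_limit (a s b r h0 h1 : R) :
  h0 < h1 -> (forall h, h0 < h < h1 -> a + s * h < b + r * h) ->
  a + s * h0 <= b + r * h0 /\ a + s * h1 <= b + r * h1.
Proof.
  intros H01 H.
  assert (K : forall h2 h3, h0 < h2 < h1 -> (h3 = h0 \/ h3 = h1) -> a + s * h3 <= b + r * h3).
  { intros h2 h3 H2 H3. apply Rnot_lt_le. intros Hlt.
    pose proof (H h2 H2) as Hh2.
    set (D2 := b + r * h2 - (a + s * h2)) in *. set (D3 := a + s * h3 - (b + r * h3)).
    assert (0 < D2) by (unfold D2; lra). assert (0 < D3) by (unfold D3; lra).
    (* The point [h2 + t * (h3 - h2)] is where the two lines would meet. *)
    set (t := D2 / (D2 + D3)).
    assert (Et : t * (D2 + D3) = D2) by (unfold t; field; lra).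
    assert (0 < t < 1) by (split; nra).
    assert (Hh : h0 < h2 + t * (h3 - h2) < h1) by (destruct H3; subst h3; split; nra).
    specialize (H _ Hh). unfold D2, D3 in Et. nra. }
  split; apply (K ((h0 + h1) / 2)); lra || auto.
Qed.

(* A cap consists of the straight segments from [(px u, py u)] and [(px v, py v)]
   to the higher point [(qx (u, v), qy (u, v))]; the boolean of an arm selects
   one of the two segments. *)
Definition base (a : nat * nat * bool) : nat := if snd a then snd (fst a) else fst (fst a).

Definition arm_pos (px py : nat -> R) (qx qy : nat * nat -> R) (a : nat * nat * bool) (h : R) : R :=
  px (base a) + (h - py (base a)) *
    ((qx (fst a) - px (base a)) / (qy (fst a) - py (base a))).

(** The ranges of heights are closed, so distinct edges have distinct apexes and no apex coincides
    with a vertex of [V]. *)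
Record cap_system (V : list nat) (E : list (nat * nat))
    (px py : nat -> R) (qx qy : nat * nat -> R) : Prop := {
  cap_ordered : forall e, In e E -> (fst e < snd e)%nat;
  cap_ends : forall a, In (fst a) E -> In (base a) V;
  cap_up : forall a, In (fst a) E -> py (base a) < qy (fst a);
  cap_vertex : forall a u, In (fst a) E -> In u V -> u <> base a ->
    py (base a) <= py u <= qy (fst a) -> arm_pos px py qx qy a (py u) <> px u;
  cap_cross : forall a a' h, In (fst a) E -> In (fst a') E -> a <> a' ->
    py (base a) <= h <= qy (fst a) -> py (base a') <= h <= qy (fst a') ->
    arm_pos px py qx qy a h = arm_pos px py qx qy a' h ->
    (base a = base a' /\ h = py (base a)) \/ (fst a = fst a' /\ h = qy (fst a)) }.

(** * The sweep by a horizontal line *)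

Section Sweep.

Context (V : list nat) (E : list (nat * nat)) (px py : nat -> R) (qx qy : nat * nat -> R)
  (Hcap : cap_system V E px py qx qy).

Let pos := arm_pos px py qx qy.
Local Notation arm := (nat * nat * bool)%type.

(** Only the open common range of heights counts, so that arms sharing a base or an apex remain
    comparable. The relation is vacuous for disjoint ranges and hence not transitive; words are
    therefore ordered pairwise, by [StronglySorted]. *)
Definition left_of (a b : nat * nat * bool) : Prop :=
  forall h, py (base a) < h < qy (fst a) -> py (base b) < h < qy (fst b) ->
  arm_pos px py qx qy a h < arm_pos px py qx qy b h.

Lemma arm_pos_affine (a : arm) : exists c s, forall h, pos a h = c + s * h.
Proof.
  unfold pos, arm_pos. set (s := _ / _).
  exists (px (base a) - s * py (base a)), s. intros h. ring.
Qed.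

Lemma arm_pos_base (a : arm) : pos a (py (base a)) = px (base a).
Proof. unfold pos, arm_pos. ring. Qed.

Lemma arm_pos_apex (a : arm) : In (fst a) E -> pos a (qy (fst a)) = qx (fst a).
Proof.
  intros Ha. pose proof (cap_up _ _ _ _ _ _ Hcap a Ha). unfold pos, arm_pos. field. lra.
Qed.

(** The strict order inside the common range becomes a weak one at its ends by continuity; the last
    two inequalities make this range nondegenerate. *)
Lemma left_of_limit (a b : arm) h :
  left_of a b -> In (fst a) E -> In (fst b) E ->
  py (base a) <= h <= qy (fst a) -> py (base b) <= h <= qy (fst b) ->
  py (base a) < qy (fst b) -> py (base b) < qy (fst a) ->
  pos a h <= pos b h.
Proof.
  intros Hl Ha Hb H1 H2 H3 H4.
  pose proof (cap_up _ _ _ _ _ _ Hcap a Ha). pose proof (cap_up _ _ _ _ _ _ Hcap b Hb).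
  set (lo := Rmax (py (base a)) (py (base b))).
  set (hi := Rmin (qy (fst a)) (qy (fst b))).
  assert (Hlohi : lo < hi /\ lo <= h <= hi /\ py (base a) <= lo /\ py (base b) <= lo /\
    hi <= qy (fst a) /\ hi <= qy (fst b)).
  { unfold lo, hi, Rmax, Rmin. repeat destruct (Rle_dec _ _); lra. }
  destruct (arm_pos_affine a) as (c & s & Ea). destruct (arm_pos_affine b) as (d & r & Eb).
  assert (Hin : forall h', lo < h' < hi -> c + s * h' < d + r * h').
  { intros h' Hh'. rewrite <- Ea, <- Eb. apply Hl; lra. }
  rewrite Ea, Eb. destruct (Rlt_le_dec lo h) as [Hlo|Hlo].
  - destruct (Rlt_le_dec h hi) as [Hhi|Hhi].
    + apply Rlt_le, Hin. lra.
    + replace h with hi by lra. now apply (affine_le_limit _ _ _ _ lo hi).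
  - replace h with lo by lra. now apply (affine_le_limit _ _ _ _ lo hi).
Qed.

(** A change of order above [h0] needs a crossing strictly below both apexes, and with distinct
    bases [cap_cross] forbids it. *)
Lemma left_of_from (a b : arm) h0 :
  In (fst a) E -> In (fst b) E -> base a <> base b ->
  py (base a) <= h0 -> py (base b) <= h0 -> pos a h0 < pos b h0 ->
  (h0 = py (base a) \/ h0 = py (base b)) -> left_of a b.
Proof.
  intros Ha Hb Hab H1 H2 Hlt Hh0 h H3 H4. apply Rnot_le_lt. intros Hle.
  destruct (arm_pos_affine a) as (c & s & Ea). destruct (arm_pos_affine b) as (d & r & Eb).
  fold pos in Hle. rewrite Ea, Eb in Hle, Hlt.
  destruct (affine_crossing c s d r h0 h) as (h' & Hh' & Heq); auto.
  { destruct Hh0; lra. }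
  rewrite <- Ea, <- Eb in Heq.
  destruct (cap_cross _ _ _ _ _ _ Hcap a b h') as [[? ?]|[? ?]]; auto; try lra.
  intros ->. auto.
Qed.

Lemma slope_left_of (a b : arm) :
  base a = base b ->
  (qx (fst a) - px (base a)) / (qy (fst a) - py (base a)) <
  (qx (fst b) - px (base b)) / (qy (fst b) - py (base b)) -> left_of a b.
Proof.
  intros Hab Hs h H1 H2. unfold arm_pos. rewrite Hab in *.
  apply Rplus_lt_compat_l, Rmult_lt_compat_l; lra.
Qed.

(** The arms leaving [u] are sorted by slope. Two arms of equal slope would still coincide at the
    height of the lower apex, against [cap_cross]. *)
Lemma arms_at_vertex (ER : list (nat * nat)) (u : nat) :
  NoDup ER -> incl ER E ->
  exists B : list arm, StronglySorted left_of B /\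
    forall a, In a B <-> In (fst a) ER /\ base a = u.
Proof.
  intros Hnd Hi.
  destruct (exists_filter (fun a : arm => base a = u) (list_prod ER [true; false])) as (B & HB & HinB).
  { clear Hi. induction Hnd as [|e ER He Hnd IH]; [constructor|].
    change (NoDup ((e, true) :: (e, false) :: list_prod ER [true; false])).
    constructor; [|constructor; [|exact IH]].
    - intros [Hx|Hx]; [congruence|apply in_prod_iff in Hx; tauto].
    - intros Hx. apply in_prod_iff in Hx. tauto. }
  assert (HinB' : forall a, In a B <-> In (fst a) ER /\ base a = u).
  { intros [e s]. rewrite HinB, in_prod_iff. simpl. destruct s; tauto. }
  clear HinB.
  destruct (sort_by_key (fun a : arm => (qx (fst a) - px (base a)) / (qy (fst a) - py (base a))) B)
    as (B' & Hp & Hs); auto.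
  { intros a b Ha Hb Heq. apply HinB' in Ha as [Ha Hau], Hb as [Hb Hbu].
    apply Hi in Ha, Hb. apply NNPP. intros Hab.
    pose proof (cap_up _ _ _ _ _ _ Hcap a Ha) as Ua. pose proof (cap_up _ _ _ _ _ _ Hcap b Hb) as Ub.
    set (h := Rmin (qy (fst a)) (qy (fst b))).
    assert (Hh : py u < h /\ h <= qy (fst a) /\ h <= qy (fst b)).
    { rewrite Hau in Ua. rewrite Hbu in Ub. unfold h, Rmin. destruct (Rle_dec _ _); lra. }
    destruct (cap_cross _ _ _ _ _ _ Hcap a b h) as [[_ He]|[He _]]; auto.
    - rewrite Hau. lra.
    - rewrite Hbu. lra.
    - unfold arm_pos. rewrite Heq, Hau, Hbu. reflexivity.
    - rewrite Hau in He. lra.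
    - pose proof (cap_ordered _ _ _ _ _ _ Hcap _ Ha) as Ho.
      destruct a as [ea sa], b as [eb sb]. simpl in He. subst eb.
      unfold base in *. simpl in *. destruct sa, sb; simpl in *; auto; lia. }
  exists B'. split.
  - assert (HB' : forall a, In a B' -> base a = u).
    { intros a Ha. apply (Permutation_in _ (Permutation_sym Hp)), HinB' in Ha. tauto. }
    clear - Hs HB'. induction B' as [|a B' IH]; [constructor|].
    apply StronglySorted_inv in Hs as [Hs Ha]. constructor.
    + apply IH; auto. intros; apply HB'; now right.
    + rewrite Forall_forall in *. intros b Hb. apply slope_left_of; [|now apply Ha].
      rewrite (HB' a), (HB' b); auto; [now right|now left].
  - intros a. rewrite <- HinB'. split; apply Permutation_in; [symmetry|]; auto.
Qed.

(* [VR] and [ER] are the vertices and apexes above the sweep line,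
   [l] lists the arms that cross it.  A vertex inserts its block of arms, which
   costs at most 4; an apex deletes two consecutive arms. *)
Lemma sweep_bound (n : nat) : forall VR ER (l : list arm),
  (length VR + length ER <= n)%nat -> NoDup ER -> incl ER E -> incl VR V ->
  (forall a, In a l <-> In (fst a) ER /\ ~ In (base a) VR) ->
  (forall a e, In a l -> In e ER -> py (base a) < qy e) ->
  (forall a u, In a l -> In u VR -> py (base a) <= py u) ->
  StronglySorted left_of l ->
  (length ER <= 4 * length VR + word_cost ER (map base l))%nat.
Proof.
  induction n as [|n IH]; intros VR ER l Hn Hnd HE HV I1 I2 I3 I4.
  { destruct ER; simpl in *; lia. }
  destruct (classic (ER = [])) as [->|HER]; [simpl; lia|].
  destruct (exists_argmin qy ER HER) as (e & He & Hmin).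
  (* The next event is the lowest remaining vertex if it is strictly below the lowest apex [e], and
     otherwise that apex; ties go to the apex. *)
  destruct (classic (exists u, In u VR /\ py u < qy e)) as [(u0 & Hu0 & Hlt0)|Hno].
  - destruct (exists_argmin py VR) as (u & Hu & Humin); [intros ->; destruct Hu0|].
    assert (Hlt : forall e', In e' ER -> py u < qy e').
    { intros e' He'. pose proof (Hmin e' He'). pose proof (Humin u0 Hu0). lra. }
    destruct (arms_at_vertex ER u Hnd HE) as (B & HB & HinB).
    assert (Hl : forall c, In c l -> In (fst c) E /\ base c <> u /\ py (base c) <= py u <= qy (fst c)).
    { intros c Hc. pose proof (I3 c u Hc Hu). apply I1 in Hc as [Hc1 Hc2].
      pose proof (Hlt _ Hc1). split; [auto|]. split; [intros Heq; rewrite Heq in Hc2; auto|lra]. }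
    (* The arms passing to the left of [u] form a prefix of the word, after which the block of [u]
       is inserted. By [cap_vertex] the other arms pass strictly to the right. *)
    destruct (sorted_cut left_of (fun c => pos c (py u) < px u) l I4) as (l1 & l2 & -> & Hl1 & Hl2).
    { intros a b Ha Hb Hab Hlb. apply Rle_lt_trans with (pos b (py u)); [|exact Hlb].
      pose proof (I2 a (fst b) Ha (proj1 (proj1 (I1 b) Hb))).
      pose proof (I2 b (fst a) Hb (proj1 (proj1 (I1 a) Ha))).
      destruct (Hl a Ha) as (? & _ & ?), (Hl b Hb) as (? & _ & ?).
      apply left_of_limit; auto. }
    assert (Hlen : (length (remove Nat.eq_dec u VR) < length VR)%nat) by now apply remove_length_lt.
    assert (Hin : forall a, In a (l1 ++ B ++ l2) <-> In a (l1 ++ l2) \/ In a B).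
    { intros a. rewrite !in_app_iff. tauto. }
    assert (HBE : forall a, In a B -> In (fst a) E /\ base a = u).
    { intros a Ha. apply HinB in Ha as [Ha1 Ha2]. auto. }
    specialize (IH (remove Nat.eq_dec u VR) ER (l1 ++ B ++ l2)).
    assert (G : (length ER <= 4 * length (remove Nat.eq_dec u VR) +
      word_cost ER (map base (l1 ++ B ++ l2)))%nat).
    { apply IH; auto.
      - lia.
      - intros x Hx. apply in_remove in Hx as [Hx _]. auto.
      - intros a. rewrite Hin, I1, HinB. split.
        + intros [[H1 H2]|[H1 H2]]; (split; [auto|]); intros Hr; apply in_remove in Hr; tauto.
        + intros [H1 H2]. destruct (Nat.eq_dec (base a) u) as [Hau|Hau]; [auto|].
          left. split; [auto|]. intros H3. apply H2, in_in_remove; auto.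
      - intros a e' Ha He'. apply Hin in Ha as [Ha|Ha]; [auto|].
        destruct (HBE a Ha) as [_ ->]. auto.
      - intros a v Ha Hv. apply in_remove in Hv as [Hv _].
        apply Hin in Ha as [Ha|Ha]; [auto|]. destruct (HBE a Ha) as [_ ->]. auto.
      - apply StronglySorted_app in I4 as (S1 & S2 & S3).
        rewrite !StronglySorted_app. repeat split; auto.
        + intros a b Ha Hb. destruct (HBE a Ha) as [Ha1 Ha2].
          destruct (Hl b) as (Hb1 & Hb2 & Hb3); [apply in_or_app; auto|].
          apply (left_of_from a b (py u)); auto; rewrite ?Ha2; auto; try lra.
          rewrite <- Ha2 at 1. rewrite arm_pos_base, Ha2.
          apply Hl2, Rnot_lt_le in Hb.
          pose proof (cap_vertex _ _ _ _ _ _ Hcap b u Hb1 (HV u Hu) ltac:(auto) Hb3).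
          unfold pos in *. lra.
        + intros a b Ha Hb. apply in_app_or in Hb as [Hb|Hb]; [|auto].
          destruct (HBE b Hb) as [Hb1 Hb2].
          destruct (Hl a) as (Ha1 & Ha2 & Ha3); [apply in_or_app; auto|].
          apply (left_of_from a b (py u)); auto; rewrite ?Hb2; auto; try lra.
          rewrite <- Hb2 at 2. rewrite arm_pos_base, Hb2. auto. }
    rewrite !map_app in *.
    pose proof (word_cost_insert ER (map base l1) (map base B) (map base l2) u) as Hw.
    assert (Hmb : forall x, In x (map base B) -> x = u).
    { intros x Hx. apply in_map_iff in Hx as (a & <- & Ha). now apply HBE. }
    specialize (Hw Hmb). lia.
  - assert (HeE : In e E) by auto.
    pose proof (cap_ordered _ _ _ _ _ _ Hcap e HeE) as Hord.
    assert (Hside : forall s, In (e, s) l).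
    { intros s. apply I1. split; [auto|]. intros Hb. apply Hno. exists (base (e, s)).
      split; [auto|]. apply (cap_up _ _ _ _ _ _ Hcap (e, s) HeE). }
    assert (Hdec : exists s l1 m l2, l = l1 ++ (e, s) :: m ++ (e, negb s) :: l2).
    { destruct (in_split _ _ (Hside true)) as (l1 & l2 & ->).
      destruct (in_app_or _ _ _ (Hside false)) as [Hf|[Hf|Hf]]; [|discriminate|].
      - destruct (in_split _ _ Hf) as (l3 & l4 & ->).
        exists false, l3, l4, l2. rewrite <- app_assoc. reflexivity.
      - destruct (in_split _ _ Hf) as (l3 & l4 & ->).
        exists true, l1, l3, l4. reflexivity. }
    destruct Hdec as (s & l1 & m & l2 & ->).
    assert (Hfst : forall a, In a (l1 ++ (e, s) :: m ++ (e, negb s) :: l2) ->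
      In (fst a) E /\ py (base a) <= qy e <= qy (fst a)).
    { intros a Ha. pose proof (I2 a e Ha He). apply I1 in Ha as [Ha _].
      split; [auto|]. pose proof (Hmin _ Ha). lra. }
    pose proof I4 as Ss. apply StronglySorted_app in Ss as (S1 & S2 & S3).
    apply StronglySorted_inv in S2 as [S2 S4]. rewrite Forall_forall in S4.
    apply StronglySorted_app in S2 as (S5 & S6 & S7).
    apply StronglySorted_inv in S6 as [S6 S8]. rewrite Forall_forall in S8.
    (* An arm between the two arms of [e] would be squeezed through the apex of [e], against
       [cap_cross]. *)
    assert (Hm : m = []).
    { destruct m as [|c m]; [auto|exfalso].
      assert (Hc : In c (l1 ++ (e, s) :: (c :: m) ++ (e, negb s) :: l2)).
      { rewrite !in_app_iff. simpl. rewrite in_app_iff. tauto. }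
      assert (Hc1 : left_of (e, s) c) by (apply S4; simpl; auto).
      assert (Hc2 : left_of c (e, negb s)) by (apply S7; simpl; auto).
      destruct (Hfst c Hc) as [HcE Hcq].
      pose proof (I2 c e Hc He) as Hce.
      assert (Hcs : forall s', py (base (e, s')) < qy (fst c)).
      { intros s'. pose proof (cap_up _ _ _ _ _ _ Hcap (e, s') HeE) as Hup. simpl in Hup. lra. }
      assert (Hes : forall s', py (base (e, s')) <= qy e <= qy (fst (e, s'))).
      { intros s'. pose proof (cap_up _ _ _ _ _ _ Hcap (e, s') HeE) as Hup. simpl in *. lra. }
      assert (P1 : pos (e, s) (qy e) <= pos c (qy e)) by (apply left_of_limit; auto).
      assert (P2 : pos c (qy e) <= pos (e, negb s) (qy e)) by (apply left_of_limit; auto).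
      pose proof (arm_pos_apex (e, s) HeE) as A1. pose proof (arm_pos_apex (e, negb s) HeE) as A2.
      simpl in A1, A2.
      assert (Hne : fst c <> e).
      { intros Hf. destruct c as [e' s']. simpl in Hf. subst e'.
        assert (Hirr : forall x, In (fst x) E -> ~ left_of x x).
        { intros x Hx Hxx. pose proof (cap_up _ _ _ _ _ _ Hcap x Hx).
          specialize (Hxx ((py (base x) + qy (fst x)) / 2)). lra. }
        apply (Hirr (e, s')); [exact HeE|].
        destruct s, s'; simpl in *; assumption. }
      destruct (cap_cross _ _ _ _ _ _ Hcap c (e, s) (qy e)) as [[_ Hx]|[Hx _]]; auto.
      - intros ->. auto.
      - unfold pos in *. lra.
      - lra. }
    subst m. cbn [app] in *.
    destruct (in_split _ _ He) as (E1 & E2 & ->).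
    pose proof (NoDup_remove _ _ _ Hnd) as [Hnd' HeN].
    assert (HER' : forall e', In e' (E1 ++ e :: E2) <-> e' = e \/ In e' (E1 ++ E2)).
    { intros e'. rewrite !in_app_iff. simpl. intuition. }
    assert (Hll : forall a, In a (l1 ++ l2) -> In a (l1 ++ (e, s) :: (e, negb s) :: l2)).
    { intros a. rewrite !in_app_iff. simpl. tauto. }
    assert (Hirr : forall a b, In (fst a) E -> left_of a b -> a <> b).
    { intros a b Ha Hab <-. pose proof (cap_up _ _ _ _ _ _ Hcap a Ha).
      specialize (Hab ((py (base a) + qy (fst a)) / 2)). lra. }
    assert (HE' : incl (E1 ++ E2) E) by (intros x Hx; apply HE, HER'; auto).
    assert (G : (length (E1 ++ E2) <= 4 * length VR + word_cost (E1 ++ E2) (map base (l1 ++ l2)))%nat).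
    { apply (IH VR (E1 ++ E2) (l1 ++ l2)); auto.
      - rewrite !length_app in *. simpl in Hn. lia.
      - intros a. split.
        + intros Ha. pose proof (Hfst a (Hll a Ha)) as [HaE _].
          assert (Hf : fst a <> e).
          { intros Hf. assert (Hor : a = (e, s) \/ a = (e, negb s)).
            { destruct a as [e' s']. simpl in Hf. subst. destruct s, s'; auto. }
            apply in_app_or in Ha as [Ha|Ha].
            - destruct Hor as [->| ->].
              + apply (Hirr (e, s) (e, s)); auto. apply S3; simpl; auto.
              + apply (Hirr (e, negb s) (e, negb s)); auto. apply S3; simpl; auto.
            - destruct Hor as [->| ->].
              + apply (Hirr (e, s) (e, s)); auto. apply S4; simpl; auto.
              + apply (Hirr (e, negb s) (e, negb s)); auto. }
          apply Hll, I1 in Ha as [Ha1 Ha2]. apply HER' in Ha1. tauto.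
        + intros [Ha1 Ha2]. assert (Ha : In a (l1 ++ (e, s) :: (e, negb s) :: l2)).
          { apply I1. split; [apply HER'; auto|auto]. }
          assert (Hf : fst a <> e) by (intros Hf; rewrite Hf in Ha1; auto).
          rewrite in_app_iff in *. simpl in Ha.
          destruct Ha as [Ha|[<-|[<-|Ha]]]; auto; now destruct Hf.
      - intros a e' Ha He'. apply I2; [auto|]. apply HER'. auto.
      - apply StronglySorted_app. split; [auto|split; [auto|]].
        intros a b Ha Hb. apply S3; simpl; auto. }
    (* The drop of the cost pays for the completed edge [e]. Its pair is gone from [E1 ++ E2] in
       both orientations, by [NoDup] and [cap_ordered]. *)
    assert (Hw : (word_cost (E1 ++ E2) (map base l1 ++ map base l2) + 1 <=
      word_cost (E1 ++ e :: E2) (map base l1 ++ base (e, s) :: base (e, negb s) :: map base l2))%nat).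
    { apply word_cost_cancel.
      - intros x Hx. apply HER'. auto.
      - unfold base. simpl. destruct s; simpl; lia.
      - destruct e as [u v]. unfold is_edge, base. destruct s; simpl; auto.
      - assert (Hn1 : ~ In (fst e, snd e) (E1 ++ E2)) by (destruct e; auto).
        assert (Hn2 : ~ In (snd e, fst e) (E1 ++ E2)).
        { intros Hx. apply HE', (cap_ordered _ _ _ _ _ _ Hcap) in Hx. simpl in Hx. lia. }
        unfold is_edge, base. destruct s; simpl; tauto. }
    rewrite !map_app in *. cbn [map] in *. rewrite !length_app in *. simpl in *. lia.
Qed.

End Sweep.

Lemma cap_system_sparse V E px py qx qy :
  cap_system V E px py qx qy -> NoDup E -> (length E <= 4 * length V)%nat.
Proof.
  intros Hcap Hnd.
  pose proof (sweep_bound V E px py qx qy Hcap (length V + length E) V E []) as H.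
  simpl in H. rewrite Nat.add_0_r in H. apply H; auto using incl_refl, SSorted_nil.
  - intros a. split; [tauto|]. intros [H1 H2]. apply H2, (cap_ends _ _ _ _ _ _ Hcap), H1.
  - tauto.
  - tauto.
Qed.

(** * Exact pairs of discs are the edges of a crossing-free system of caps *)

(** The function [p] of the vector from the site [(bx k, bz k)] to [(x, h)], less the weight [w k]:
    an additively weighted distance, meaningful for [bz k < h]. *)
Definition wdist (bx bz w : nat -> R) (k : nat) (x h : R) : R :=
  (x - bx k) ^ 2 / (h - bz k) + (h - bz k) - w k.

(** With [bz] the height of the lowest point and [w] twice the radius, this expression is the
    squared distance of the centers less the squared difference of the radii, so its positivity
    excludes nesting. *)
Definition separated (bx bz w : nat -> R) (u v : nat) : Prop :=
  0 < (bx u - bx v) ^ 2 + (bz u - bz v) ^ 2 + (bz u - bz v) * (w u - w v).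

(** A point on the Voronoi edge of [u] and [v], away from all other cells. Only sites below height
    [h] compete; a site at height [h] matters only if it is the point itself, which [apex_off]
    excludes. *)
Record apex (V : list nat) (bx bz w : nat -> R) (u v : nat) (x h : R) : Prop := {
  apex_above_l : bz u < h;
  apex_above_r : bz v < h;
  apex_eq : wdist bx bz w u x h = wdist bx bz w v x h;
  apex_lt : forall k, In k V -> k <> u -> k <> v -> bz k < h ->
    wdist bx bz w u x h < wdist bx bz w k x h;
  apex_off : forall k, In k V -> bz k = h -> bx k <> x }.

Section Caps.

Context (V : list nat) (bx bz w : nat -> R)
  (Hsep : forall u v, In u V -> In v V -> u <> v -> separated bx bz w u v).

Let F := wdist bx bz w.

Lemma wdist_ray k m h : bz k < h -> F k (bx k + m * (h - bz k)) h = (m ^ 2 + 1) * (h - bz k) - w k.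
Proof. intros H. unfold F, wdist. field. lra. Qed.

(** Subadditivity of [p] with its exact defect: [(m ^ 2 + 1) * d] is the value of [p] on the step
    [(m * d, d)], and the subtracted square vanishes only if the step is parallel to the vector from
    the site. *)
Lemma wdist_step k x h m d : bz k < h -> 0 <= d ->
  F k (x + m * d) (h + d) =
  F k x h + (m ^ 2 + 1) * d -
  d * ((x - bx k - m * (h - bz k)) ^ 2 / ((h - bz k) * (h + d - bz k))).
Proof. intros H Hd. unfold F, wdist. field. lra. Qed.

Lemma wdist_step_le k x h m d : bz k < h -> 0 <= d ->
  F k (x + m * d) (h + d) <= F k x h + (m ^ 2 + 1) * d.
Proof.
  intros H Hd. rewrite wdist_step by auto.
  enough (0 <= d * ((x - bx k - m * (h - bz k)) ^ 2 / ((h - bz k) * (h + d - bz k)))) by lra.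
  apply Rmult_le_pos; [auto|]. apply Rmult_le_pos; [apply pow2_ge_0|].
  apply Rlt_le, Rinv_0_lt_compat, Rmult_lt_0_compat; lra.
Qed.

Lemma wdist_step_eq k x h m d : bz k < h -> 0 < d ->
  F k (x + m * d) (h + d) = F k x h + (m ^ 2 + 1) * d -> x - bx k = m * (h - bz k).
Proof.
  intros H Hd He. rewrite wdist_step in He by lra.
  set (y := x - bx k - m * (h - bz k)) in *.
  assert (Hq : 0 < / ((h - bz k) * (h + d - bz k))).
  { apply Rinv_0_lt_compat, Rmult_lt_0_compat; lra. }
  unfold Rdiv in He. set (q := / _) in *.
  assert (Hy : d * q * (y * y) = 0) by nra.
  apply Rmult_integral in Hy as [Hy|Hy]; [nra|].
  apply Rmult_integral in Hy. unfold y in Hy. lra.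
Qed.

(** Cells are star-shaped: going up a ray from [u], the distance to [u] grows by the full [p] of the
    step and that to [k] by no more. A failure at [h] therefore forces equality throughout, so [k]
    lies on the line of the ray with equal distance, against [separated]. *)
Lemma ray_in_cell u k m h h' :
  In u V -> In k V -> u <> k -> bz u < h -> bz k < h -> h < h' ->
  F u (bx u + m * (h' - bz u)) h' <= F k (bx u + m * (h' - bz u)) h' ->
  F u (bx u + m * (h - bz u)) h < F k (bx u + m * (h - bz u)) h.
Proof.
  intros Hu Hk Huk Huh Hkh Hh Hle. apply Rnot_le_lt. intros Hge.
  replace (bx u + m * (h' - bz u)) with (bx u + m * (h - bz u) + m * (h' - h)) in Hle by ring.
  set (x := bx u + m * (h - bz u)) in *.
  assert (Eu : F u x h = (m ^ 2 + 1) * (h - bz u) - w u) by (apply wdist_ray; auto).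
  assert (Eu' : F u (x + m * (h' - h)) h' = (m ^ 2 + 1) * (h' - bz u) - w u).
  { unfold x. rewrite <- wdist_ray by lra. f_equal. ring. }
  pose proof (wdist_step_le k x h m (h' - h) Hkh ltac:(lra)) as Hstep.
  pose proof (wdist_step_eq k x h m (h' - h) Hkh ltac:(lra)) as Heq.
  replace (h + (h' - h)) with h' in * by ring.
  assert (Hcol : x - bx k = m * (h - bz k)) by (apply Heq; lra).
  assert (Ek : F k x h = (m ^ 2 + 1) * (h - bz k) - w k).
  { rewrite <- wdist_ray by auto. f_equal. lra. }
  pose proof (Hsep u k Hu Hk Huk) as Hs. unfold separated in Hs.
  assert (Hb : (m ^ 2 + 1) * (bz u - bz k) = w k - w u) by lra.
  replace (bx u - bx k) with (m * (bz u - bz k)) in Hs by (unfold x in Hcol; lra).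
  replace (w u - w k) with (- ((m ^ 2 + 1) * (bz u - bz k))) in Hs by lra.
  nra.
Qed.

(** If [k] were on the ray, both distances would be affine along it, and [separated] would make [k]
    strictly closer than [u] at height [h']. *)
Lemma vertex_off_ray u k m h' :
  In u V -> In k V -> u <> k -> bz u <= bz k -> bz k < h' ->
  F u (bx u + m * (h' - bz u)) h' <= F k (bx u + m * (h' - bz u)) h' ->
  bx u + m * (bz k - bz u) <> bx k.
Proof.
  intros Hu Hk Huk Hle Hlt HF Heq.
  rewrite wdist_ray in HF by lra.
  replace (bx u + m * (h' - bz u)) with (bx k + m * (h' - bz k)) in HF by (rewrite <- Heq; ring).
  rewrite wdist_ray in HF by lra.
  pose proof (Hsep u k Hu Hk Huk) as Hs. unfold separated in Hs.
  replace (bx u - bx k) with (m * (bz u - bz k)) in Hs by lra.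
  assert (Hb : (m ^ 2 + 1) * (bz k - bz u) <= w u - w k) by lra.
  assert (0 <= (bz k - bz u) * ((w u - w k) - (m ^ 2 + 1) * (bz k - bz u))).
  { apply Rmult_le_pos; lra. }
  nra.
Qed.

Lemma apex_sym u v x h : apex V bx bz w u v x h -> apex V bx bz w v u x h.
Proof.
  intros [H1 H2 H3 H4 H5]. split; auto.
  intros k Hk Hkv Hku Hkh. rewrite <- H3. auto.
Qed.

Lemma apex_le u v x h k : apex V bx bz w u v x h -> In k V -> bz k < h ->
  F u x h <= F k x h /\ F v x h <= F k x h.
Proof.
  intros [H1 H2 H3 H4 H5] Hk Hkh. unfold F.
  destruct (Nat.eq_dec k u) as [->|Hku]; [lra|].
  destruct (Nat.eq_dec k v) as [->|Hkv]; [lra|].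
  specialize (H4 k Hk Hku Hkv Hkh). lra.
Qed.

Lemma apex_pair u v u' v' x h : In u V -> In v V -> In u' V -> In v' V ->
  apex V bx bz w u v x h -> apex V bx bz w u' v' x h -> u' = u \/ u' = v.
Proof.
  intros Hu Hv Hu' Hv' A A'. apply NNPP. intros Hn.
  pose proof (apex_lt _ _ _ _ _ _ _ _ A u' Hu' ltac:(tauto) ltac:(tauto)
    (apex_above_l _ _ _ _ _ _ _ _ A')) as Hlt.
  pose proof (apex_le _ _ _ _ u A' Hu (apex_above_l _ _ _ _ _ _ _ _ A)) as [Hle _].
  unfold F in Hle. lra.
Qed.

(** Below its apex an arm stays in the open cell of its base, so arms with distinct bases can meet
    only at an apex of both, and an apex determines its pair of sites. *)
Lemma apexes_cap_system (E : list (nat * nat)) (qx qy : nat * nat -> R) :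
  (forall e, In e E -> (fst e < snd e)%nat /\ In (fst e) V /\ In (snd e) V /\
     apex V bx bz w (fst e) (snd e) (qx e) (qy e)) ->
  cap_system V E bx bz qx qy.
Proof.
  intros HE.
  set (other := fun a : nat * nat * bool => base (fst a, negb (snd a))).
  assert (Harm : forall a, In (fst a) E -> In (base a) V /\ In (other a) V /\
    base a <> other a /\ apex V bx bz w (base a) (other a) (qx (fst a)) (qy (fst a))).
  { intros [e s] Ha. destruct (HE e Ha) as (H1 & H2 & H3 & H4).
    unfold other, base. destruct s; simpl.
    - split; [auto|split; [auto|split; [lia|]]]. apply apex_sym, H4.
    - split; [auto|split; [auto|split; [lia|auto]]]. }
  assert (Heqarm : forall a a', In (fst a) E -> fst a = fst a' -> base a = base a' -> a = a').
  { intros [e s] [e' s'] Ha He Hb. simpl in *. subst e'. destruct (HE e Ha) as (H1 & _).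
    unfold base in Hb. destruct s, s'; simpl in Hb; auto; lia. }
  assert (Hsame : forall e e', In e E -> In e' E -> qx e = qx e' -> qy e = qy e' -> e = e').
  { intros [u v] [u' v'] He He' Hx Hy.
    destruct (HE _ He) as (H1 & H2 & H3 & A), (HE _ He') as (H1' & H2' & H3' & A').
    rewrite Hx, Hy in A. simpl in *.
    destruct (apex_pair _ _ _ _ _ _ H2 H3 H2' H3' A A') as [->| ->];
    destruct (apex_pair _ _ _ _ _ _ H2 H3 H3' H2' A (apex_sym _ _ _ _ A')) as [->| ->];
      auto; lia. }
  set (sl := fun a : nat * nat * bool => (qx (fst a) - bx (base a)) / (qy (fst a) - bz (base a))).
  assert (Hpos : forall a h, arm_pos bx bz qx qy a h = bx (base a) + sl a * (h - bz (base a))).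
  { intros a h. unfold arm_pos, sl. ring. }
  assert (Hup : forall a, In (fst a) E -> bz (base a) < qy (fst a)).
  { intros a Ha. destruct (Harm a Ha) as (_ & _ & _ & A). apply A. }
  assert (Hqx : forall a, In (fst a) E ->
    qx (fst a) = bx (base a) + sl a * (qy (fst a) - bz (base a))).
  { intros a Ha. pose proof (Hup a Ha). unfold sl. field. lra. }
  assert (Hcell : forall a k h, In (fst a) E -> In k V -> base a <> k ->
    bz (base a) < h -> bz k < h -> h < qy (fst a) ->
    F (base a) (arm_pos bx bz qx qy a h) h < F k (arm_pos bx bz qx qy a h) h).
  { intros a k h Ha Hk Hak H1 H2 H3. destruct (Harm a Ha) as (Hb & _ & _ & A).
    rewrite Hpos. apply ray_in_cell with (qy (fst a)); auto.
    rewrite <- Hqx by auto. apply (apex_le _ _ _ _ k A); auto. lra. }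
  assert (Hvert : forall a u, In (fst a) E -> In u V -> u <> base a ->
    bz (base a) <= bz u <= qy (fst a) -> arm_pos bx bz qx qy a (bz u) <> bx u).
  { intros a u Ha Hu Hua [H1 H2]. destruct (Harm a Ha) as (Hb & _ & _ & A).
    rewrite Hpos. destruct (Rlt_le_dec (bz u) (qy (fst a))) as [Hlt|Hge].
    - apply vertex_off_ray with (qy (fst a)); auto.
      rewrite <- Hqx by auto. apply (apex_le _ _ _ _ u A); auto.
    - assert (Huq : bz u = qy (fst a)) by lra. rewrite Huq, <- Hqx by auto.
      intros Hx. apply (apex_off _ _ _ _ _ _ _ _ A u); auto. }
  (* Of two overlapping arms, the lower apex would lie inside the longer arm, hence in the open cell
     of the base, although it is equally far from the base and from [other a]. *)
  assert (Hbelow : forall a a', In (fst a) E -> In (fst a') E -> base a = base a' ->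
    fst a <> fst a' -> sl a = sl a' -> qy (fst a) <= qy (fst a') -> False).
  { intros a a' Ha Ha' Hb Hne Hsl Hq.
    destruct (Harm a Ha) as (Hba & Ho & Hbo & A).
    destruct (Rlt_le_dec (qy (fst a)) (qy (fst a'))) as [Hlt|Hge].
    - pose proof (Hcell a' (other a) (qy (fst a)) Ha' Ho) as Hc.
      rewrite Hpos, <- Hb, <- Hsl, <- Hqx in Hc by auto.
      pose proof (apex_eq _ _ _ _ _ _ _ _ A) as He. unfold F in Hc.
      rewrite He in Hc. pose proof (Hup a Ha).
      pose proof (apex_above_r _ _ _ _ _ _ _ _ A). specialize (Hc Hbo). lra.
    - assert (Hqq : qy (fst a) = qy (fst a')) by lra. apply Hne, Hsame; auto.
      rewrite (Hqx a), (Hqx a') by auto. rewrite Hb, Hsl, Hqq. reflexivity. }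
  split; auto.
  - intros e He. now apply HE.
  - intros a Ha. now apply Harm.
  - intros a a' h Ha Ha' Hne [H1 H2] [H3 H4] Heq.
    destruct (Nat.eq_dec (base a) (base a')) as [Hb|Hb].
    + left. split; [auto|]. destruct (Rle_lt_dec h (bz (base a))) as [Hle|Hlt]; [lra|exfalso].
      assert (Hsl : sl a = sl a').
      { rewrite !Hpos, <- Hb in Heq. apply Rplus_eq_reg_l in Heq.
        apply Rmult_eq_reg_r in Heq; lra. }
      assert (Hf : fst a <> fst a') by (intros Hf; apply Hne, Heqarm; auto).
      destruct (Rle_lt_dec (qy (fst a)) (qy (fst a'))) as [Hq|Hq].
      * apply (Hbelow a a'); auto.
      * apply (Hbelow a' a); auto. lra.
    + right.
      destruct (Harm a Ha) as (Hba & _ & _ & A), (Harm a' Ha') as (Hba' & _ & _ & A').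
      assert (K1 : bz (base a) < h).
      { apply Rnot_le_lt. intros Hle. replace h with (bz (base a)) in * by lra.
        apply (Hvert a' (base a)); auto. rewrite <- Heq, Hpos. ring. }
      assert (K2 : bz (base a') < h).
      { apply Rnot_le_lt. intros Hle. replace h with (bz (base a')) in * by lra.
        apply (Hvert a (base a')); auto. rewrite Heq, Hpos. ring. }
      pose proof (Hcell a (base a') h Ha Hba' Hb K1 K2) as C1.
      pose proof (Hcell a' (base a) h Ha' Hba ltac:(auto) K2 K1) as C2.
      rewrite <- Heq in C2.
      (* At an apex only the weak inequality is left. It still contradicts the strict one from an
         arm that continues upwards, so both arms must end at [h]. *)
      assert (B1 : h = qy (fst a) -> F (base a) (arm_pos bx bz qx qy a h) h <=
        F (base a') (arm_pos bx bz qx qy a h) h).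
      { intros ->. rewrite Hpos, <- Hqx by auto. apply (apex_le _ _ _ _ _ A); auto. }
      assert (B2 : h = qy (fst a') -> F (base a') (arm_pos bx bz qx qy a h) h <=
        F (base a) (arm_pos bx bz qx qy a h) h).
      { rewrite Heq. intros ->. rewrite Hpos, <- Hqx by auto. apply (apex_le _ _ _ _ _ A'); auto. }
      destruct (Rlt_le_dec h (qy (fst a))) as [L1|L1], (Rlt_le_dec h (qy (fst a'))) as [L2|L2];
        try (exfalso; specialize (C1 L1)); try (exfalso; specialize (C2 L2));
        try specialize (B1 ltac:(lra)); try specialize (B2 ltac:(lra)); try lra.
      split; [|lra]. apply Hsame; auto; [|lra].
      rewrite !Hpos in Heq. rewrite (Hqx a), (Hqx a') by auto.
      replace (qy (fst a)) with h by lra. replace (qy (fst a')) with h by lra. auto.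
Qed.

(* Slide the point towards the bottom of the farther of the two discs until both
   are equally far. *)
Lemma apex_exists_lt u v x h :
  In u V -> In v V -> u <> v -> bz u < h -> bz v < h ->
  (x - bx u) * (h - bz v) <> (x - bx v) * (h - bz u) ->
  (forall k, In k V -> k <> u -> k <> v -> bz k < h -> F v x h < F k x h) ->
  F u x h < F v x h ->
  exists x' h', apex V bx bz w u v x' h'.
Proof.
  intros Hu Hv Huv Huh Hvh Hcol Hk HF.
  set (m := (x - bx v) / (h - bz v)).
  assert (Em : x - bx v = m * (h - bz v)) by (unfold m; field; lra).
  set (lo := Rmax (bz u) (bz v)).
  assert (Hlo : bz u <= lo /\ bz v <= lo /\ lo < h /\ (lo = bz u \/ lo = bz v /\ bz u < bz v)).
  { unfold lo, Rmax. destruct (Rle_dec (bz u) (bz v)); [|lra].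
    destruct (Req_dec (bz u) (bz v)); [lra|]. lra. }
  clearbody lo. destruct Hlo as (L1 & L2 & L3 & L4).
  assert (Hv0 : F v x h = (m ^ 2 + 1) * (h - bz v) - w v).
  { rewrite <- wdist_ray by auto. f_equal. lra. }
  (* [G d] is [F v - F u] at the point slid by [d], multiplied by its height above the site of [u].
     Clearing the denominator makes it a polynomial, defined down to the level of [u]. *)
  set (G := fun d => - ((x - m * d - bx u) ^ 2 + (h - d - bz u) ^ 2 -
     ((m ^ 2 + 1) * (h - d - bz v) - w v + w u) * (h - d - bz u))).
  assert (HFu : forall y g, bz u < g ->
    F u y g * (g - bz u) = (y - bx u) ^ 2 + (g - bz u) ^ 2 - w u * (g - bz u)).
  { intros y g Hg. unfold F, wdist. field. lra. }
  assert (G0 : 0 < G 0).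
  { unfold G. pose proof (HFu x h Huh) as E0.
    replace (x - m * 0 - bx u) with (x - bx u) by ring. rewrite !Rminus_0_r.
    assert (0 < (F v x h - F u x h) * (h - bz u)) by (apply Rmult_lt_0_compat; lra).
    rewrite Hv0 in *. lra. }
  assert (G1 : G (h - lo) < 0).
  (* At the level of [u] the sign comes from the noncollinearity [Hcol]; at the site of [v], if that
     is higher, it comes from [separated]. *)
  { unfold G. replace (h - (h - lo)) with lo by ring. destruct L4 as [->|[-> L4]].
    - assert (Hne : x - m * (h - bz u) - bx u <> 0).
      { intros He. apply Hcol. replace (x - bx u) with (m * (h - bz u)) by lra.
        rewrite Em. ring. }
      assert (0 < (x - m * (h - bz u) - bx u) ^ 2) by (rewrite <- Rsqr_pow2; now apply Rsqr_pos_lt). lra.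
    - replace (x - m * (h - bz v) - bx u) with (bx v - bx u) by lra.
      pose proof (Hsep v u Hv Hu ltac:(auto)) as Hs. unfold separated in Hs. lra. }
  assert (HG : continuity (fun d => - G d)) by (unfold G; reg).
  destruct (IVT (fun d => - G d) 0 (h - lo) HG ltac:(lra) ltac:(lra) ltac:(lra)) as (d & [Hd1 Hd2] & Hd).
  assert (Hd3 : 0 < d) by (destruct (Req_dec d 0) as [->|]; lra).
  assert (Hd4 : d < h - lo) by (destruct (Req_dec d (h - lo)) as [->|]; lra).
  assert (Hvd : F v (x - m * d) (h - d) = (m ^ 2 + 1) * (h - d - bz v) - w v).
  { rewrite <- wdist_ray by lra. f_equal. lra. }
  assert (Heq : F u (x - m * d) (h - d) = F v (x - m * d) (h - d)).
  { apply Rmult_eq_reg_r with (h - d - bz u); [|lra].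
    rewrite HFu by lra. rewrite Hvd. unfold G in Hd. lra. }
  exists (x - m * d), (h - d). split; try lra.
  - exact Heq.
  (* Returning to [(x, h)] adds the full [p] of the step to the distance from [v] and at most as
     much to that from [k]. *)
  - intros k HkV Hku Hkv Hkh. fold F. rewrite Heq.
    pose proof (wdist_step_le k (x - m * d) (h - d) m d Hkh ltac:(lra)) as Hs.
    replace (x - m * d + m * d) with x in Hs by ring. replace (h - d + d) with h in Hs by ring.
    pose proof (Hk k HkV Hku Hkv ltac:(lra)). lra.
  (* A site at the new point would lie on the ray from [v] to [(x, h)], and by [separated] it would
     be closer to [(x, h)] than [v]. *)
  - intros k HkV Hkh Hkx.
    assert (Hku : k <> u) by (intros ->; lra). assert (Hkv : k <> v) by (intros ->; lra).
    pose proof (Hk k HkV Hku Hkv ltac:(lra)) as Hlt.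
    replace x with (bx k + m * (h - bz k)) in Hlt at 2 by (rewrite Hkx, Hkh; ring).
    rewrite wdist_ray, Hv0 in Hlt by lra.
    pose proof (Hsep k v HkV Hv Hkv) as Hs. unfold separated in Hs.
    replace (bx k - bx v) with (m * (bz k - bz v)) in Hs by (rewrite Hkx, Hkh; lra).
    assert (0 < bz k - bz v) by lra.
    assert ((m ^ 2 + 1) * (bz k - bz v) < w v - w k) by lra.
    nra.
Qed.

Lemma apex_exists u v x h :
  In u V -> In v V -> u <> v -> bz u < h -> bz v < h ->
  (x - bx u) * (h - bz v) <> (x - bx v) * (h - bz u) ->
  (forall k, In k V -> k <> u -> k <> v -> bz k < h -> F u x h < F k x h /\ F v x h < F k x h) ->
  (forall k, In k V -> bz k = h -> bx k <> x) ->
  exists x' h', apex V bx bz w u v x' h'.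
Proof.
  intros Hu Hv Huv Huh Hvh Hcol Hk Hoff.
  destruct (Rtotal_order (F u x h) (F v x h)) as [Hlt|[Heq|Hgt]].
  - apply apex_exists_lt with x h; auto. intros k H1 H2 H3 H4. now apply Hk.
  - exists x, h. split; auto. intros k H1 H2 H3 H4. now apply Hk.
  - destruct (apex_exists_lt v u x h) as (x' & h' & A); auto.
    { intros k H1 H2 H3 H4. now apply Hk. }
    exists x', h'. now apply apex_sym.
Qed.

End Caps.

(** * Discs *)

Lemma norm_triangle (s1 t1 s2 t2 a b : R) : 0 <= a -> 0 <= b ->
  s1 ^ 2 + t1 ^ 2 <= a ^ 2 -> s2 ^ 2 + t2 ^ 2 <= b ^ 2 ->
  (s1 + s2) ^ 2 + (t1 + t2) ^ 2 <= (a + b) ^ 2.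
Proof.
  intros Ha Hb H1 H2.
  enough (s1 * s2 + t1 * t2 <= a * b) by nra.
  apply Rnot_lt_le. intros Hlt.
  assert (0 <= a * b) by nra.
  assert ((a * b) ^ 2 < (s1 * s2 + t1 * t2) ^ 2) by nra.
  assert ((s1 ^ 2 + t1 ^ 2) * (s2 ^ 2 + t2 ^ 2) <= a ^ 2 * b ^ 2).
  { apply Rmult_le_compat; nra. }
  pose proof (pow2_ge_0 (s1 * t2 - t1 * s2)). nra.
Qed.

Lemma meets_iff (d b : pdisc) : 0 < rad d -> 0 < rad b ->
  meets d b <-> (cx d - cx b) ^ 2 + (cy d - cy b) ^ 2 <= (rad d + rad b) ^ 2.
Proof.
  intros Hd Hb. split.
  - intros ([x y] & H1 & H2). unfold in_disc in *. simpl fst in *. simpl snd in *.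
    replace (cx d - cx b) with ((cx d - x) + (x - cx b)) by ring.
    replace (cy d - cy b) with ((cy d - y) + (y - cy b)) by ring.
    apply norm_triangle; lra.
  - intros H. set (t := rad d / (rad d + rad b)).
    assert (Et : t * (rad d + rad b) = rad d) by (unfold t; field; lra).
    exists (cx d + t * (cx b - cx d), cy d + t * (cy b - cy d)).
    unfold in_disc. cbn [fst snd]. split.
    + replace (rad d) with (t * (rad d + rad b)) by auto.
      assert (0 <= t ^ 2) by apply pow2_ge_0. nra.
    + replace (rad b) with ((1 - t) * (rad d + rad b)) by lra.
      assert (0 <= (1 - t) ^ 2) by apply pow2_ge_0. nra.
Qed.

Lemma uniform_margin (l : list nat) (P : nat -> R -> Prop) :
  (forall k e e', P k e -> 0 < e' <= e -> P k e') ->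
  (forall k, In k l -> exists e, 0 < e /\ P k e) ->
  exists e, 0 < e /\ forall k, In k l -> P k e.
Proof.
  intros Hmono. induction l as [|a l IH]; intros H.
  - exists 1. split; [lra|]. intros k [].
  - destruct IH as (e1 & He1 & H1); [intros; apply H; now right|].
    destruct (H a (or_introl eq_refl)) as (e2 & He2 & H2).
    assert (Hm : 0 < Rmin e1 e2 /\ Rmin e1 e2 <= e1 /\ Rmin e1 e2 <= e2).
    { unfold Rmin. destruct (Rle_dec e1 e2); lra. }
    exists (Rmin e1 e2). split; [lra|]. intros k [<-|Hk].
    + apply Hmono with e2; [auto|lra].
    + apply Hmono with e1; [auto|lra].
Qed.

(** * Exact pairs and nested discs *)

Definition bottom (D : nat -> pdisc) (k : nat) : R := cy (D k) - rad (D k).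

Definition exact_pair (D : nat -> pdisc) (V : list nat) (u v : nat) : Prop :=
  exists B, 0 < rad B /\ forall k, In k V -> (meets (D k) B <-> k = u \/ k = v).

(** Containment of [d] in [b] for positive radii, internal tangency included. *)
Definition nested (d b : pdisc) : Prop :=
  rad d <= rad b /\ (cx d - cx b) ^ 2 + (cy d - cy b) ^ 2 <= (rad b - rad d) ^ 2.

Lemma nested_meets (d b B : pdisc) : 0 < rad d -> 0 < rad b -> 0 < rad B ->
  nested d b -> meets d B -> meets b B.
Proof.
  intros Hd Hb HB [H1 H2]. rewrite !meets_iff by auto. intros H3.
  replace (cx b - cx B) with ((cx b - cx d) + (cx d - cx B)) by ring.
  replace (cy b - cy B) with ((cy b - cy d) + (cy d - cy B)) by ring.
  replace (rad b + rad B) with ((rad b - rad d) + (rad d + rad B)) by ring.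
  apply norm_triangle; lra.
Qed.

Lemma separated_of_not_nested (D : nat -> pdisc) (u v : nat) :
  ~ nested (D u) (D v) -> ~ nested (D v) (D u) ->
  separated (fun k => cx (D k)) (bottom D) (fun k => 2 * rad (D k)) u v.
Proof.
  intros H1 H2. unfold separated, bottom, nested in *.
  assert (H : (rad (D u) - rad (D v)) ^ 2 <
    (cx (D u) - cx (D v)) ^ 2 + (cy (D u) - cy (D v)) ^ 2).
  { apply Rnot_le_lt. intros Hle. destruct (Rle_lt_dec (rad (D u)) (rad (D v))).
    - apply H1. split; [auto|]. nra.
    - apply H2. split; [lra|]. nra. }
  nra.
Qed.

(* For a disc with top point [(x, h)] and radius [r], being met by [D k] means
   that [wdist] from the bottom of [D k] to [(x, h)] is at most [2 r]. *)
Lemma touch_wdist (D : nat -> pdisc) (k : nat) (x h r : R) : bottom D k < h ->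
  (cx (D k) - x) ^ 2 + (cy (D k) - (h - r)) ^ 2 <= (rad (D k) + r) ^ 2 <->
  wdist (fun k => cx (D k)) (bottom D) (fun k => 2 * rad (D k)) k x h <= 2 * r.
Proof.
  intros Hk. set (F := wdist _ _ _ _ _ _).
  assert (E : F * (h - bottom D k) = (x - cx (D k)) ^ 2 + (h - bottom D k) ^ 2 -
    2 * rad (D k) * (h - bottom D k)).
  { unfold F, wdist. field. lra. }
  assert (Ec : cy (D k) = bottom D k + rad (D k)) by (unfold bottom; ring).
  rewrite Ec. set (b := bottom D k) in *. split; intros H.
  - apply Rmult_le_reg_r with (h - b); [lra|]. rewrite E. nra.
  - apply (Rmult_le_compat_r (h - b)) in H; [|lra]. rewrite E in H. nra.
Qed.

(** The disc [B] is enlarged by a small [e] and shifted sideways by some [d <= e]. This places its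
    top strictly above the bottoms of [u] and [v] and in general position with them, while the disc
    contains [B] and still misses all other members. *)
Lemma exact_pair_apex (D : nat -> pdisc) (V : list nat) (u v : nat) :
  (forall k, In k V -> 0 < rad (D k)) ->
  (forall k l, In k V -> In l V -> k <> l ->
     separated (fun k => cx (D k)) (bottom D) (fun k => 2 * rad (D k)) k l) ->
  In u V -> In v V -> u <> v -> exact_pair D V u v ->
  exists x h, apex V (fun k => cx (D k)) (bottom D) (fun k => 2 * rad (D k)) u v x h.
Proof.
  intros Hrad Hsep Hu Hv Huv (B & HB & HBV).
  set (r := rad B) in *. set (x := cx B) in *. set (y := cy B) in *.
  (* The margin [2 * e] leaves one [e] for the growth of the radius and one for the shift. *)
  destruct (uniform_margin V (fun k e => 0 < rad (D k) -> k <> u -> k <> v ->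
    (rad (D k) + r + 2 * e) ^ 2 < (cx (D k) - x) ^ 2 + (cy (D k) - y) ^ 2)) as (e & He & Hout).
  { intros k e e' H [He1 He2] Hrk Hku Hkv. specialize (H Hrk Hku Hkv).
    assert ((rad (D k) + r + 2 * e') ^ 2 <= (rad (D k) + r + 2 * e) ^ 2); [|lra].
    apply pow_incr. lra. }
  { intros k Hk. destruct (classic (k = u \/ k = v)) as [Hor|Hno].
    { exists 1. split; [lra|tauto]. }
    pose proof (Hrad k Hk) as Hrk.
    assert (Hgap : (rad (D k) + r) ^ 2 < (cx (D k) - x) ^ 2 + (cy (D k) - y) ^ 2).
    { apply Rnot_le_lt. intros Hle. apply Hno, HBV; auto. apply meets_iff; auto. }
    set (A := rad (D k) + r) in *. set (g := _ + _) in Hgap |- *.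
    assert (HA : 0 < A) by (unfold A; lra).
    (* For [m <= 1] one has [(A + 2 * m) ^ 2 <= A ^ 2 + (4 * A + 4) * m], which is less than [g] as
       soon as [m <= e0]. *)
    set (e0 := (g - A ^ 2) / (4 * A + 8)).
    assert (Ee0 : e0 * (4 * A + 8) = g - A ^ 2) by (unfold e0; field; lra).
    assert (He0 : 0 < e0) by nra.
    assert (Hm : 0 < Rmin 1 e0 /\ Rmin 1 e0 <= 1 /\ Rmin 1 e0 <= e0).
    { unfold Rmin. destruct (Rle_dec 1 e0); lra. }
    exists (Rmin 1 e0). split; [lra|]. intros _ _ _. set (m := Rmin 1 e0) in *. nra. }
  set (h := y + r + e).
  assert (Hin : forall k, k = u \/ k = v -> In k V /\ bottom D k < h /\
    (cx (D k) - x) ^ 2 + (cy (D k) - y) ^ 2 <= (rad (D k) + r) ^ 2).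
  { intros k Hk. assert (HkV : In k V) by (destruct Hk; subst; auto).
    apply HBV in Hk; [|auto]. pose proof (Hrad k HkV). apply meets_iff in Hk; auto.
    fold r x y in Hk. split; [auto|split; [|auto]].
    assert (Hy : cy (D k) - y <= rad (D k) + r).
    { assert (Hr : 0 < rad (D k) + r) by lra.
      pose proof (pow2_ge_0 (cx (D k) - x)).
      apply Rnot_lt_le. intros Hlt. nra. }
    unfold bottom, h. lra. }
  destruct (Hin u ltac:(auto)) as (_ & Huh & Hum), (Hin v ltac:(auto)) as (_ & Hvh & Hvm).
  (* The condition is affine in [d]. If it failed at both [0] and [e], the lowest points of the two
     discs would coincide, against [separated]. *)
  assert (Hd : exists d, 0 <= d <= e /\
    (x + d - cx (D u)) * (h - bottom D v) <> (x + d - cx (D v)) * (h - bottom D u)).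
  { destruct (Req_dec ((x + 0 - cx (D u)) * (h - bottom D v))
      ((x + 0 - cx (D v)) * (h - bottom D u))) as [E0|N0]; [|exists 0; split; [lra|auto]].
    destruct (Req_dec ((x + e - cx (D u)) * (h - bottom D v))
      ((x + e - cx (D v)) * (h - bottom D u))) as [E1|N1]; [|exists e; split; [lra|auto]].
    exfalso. pose proof (Hsep u v Hu Hv Huv) as Hs. unfold separated in Hs.
    assert (Hb : e * (bottom D u - bottom D v) = 0) by nra.
    apply Rmult_integral in Hb as [Hb|Hb]; [lra|].
    replace (bottom D v) with (bottom D u) in * by lra.
    apply Rmult_eq_reg_r in E0; [|lra].
    replace (cx (D v)) with (cx (D u)) in Hs by lra. nra. }
  destruct Hd as (d & Hd & Hcol).
  assert (Hnear : forall k, k = u \/ k = v ->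
    wdist (fun k => cx (D k)) (bottom D) (fun k => 2 * rad (D k)) k (x + d) h <= 2 * (r + e)).
  { intros k Hk. destruct (Hin k Hk) as (HkV & Hkh & Hkm). pose proof (Hrad k HkV).
    apply touch_wdist; [auto|].
    replace (cx (D k) - (x + d)) with ((cx (D k) - x) + - d) by ring.
    replace (cy (D k) - (h - (r + e))) with ((cy (D k) - y) + 0) by (unfold h; ring).
    rewrite <- Rplus_assoc. apply norm_triangle; try lra. nra. }
  assert (Hfar : forall k, In k V -> k <> u -> k <> v ->
    ~ (cx (D k) - (x + d)) ^ 2 + (cy (D k) - (h - (r + e))) ^ 2 <= (rad (D k) + (r + e)) ^ 2).
  { intros k HkV Hku Hkv Hle. specialize (Hout k HkV (Hrad k HkV) Hku Hkv).
    pose proof (Hrad k HkV).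
    apply (Rlt_not_le _ _ Hout).
    replace (cx (D k) - x) with ((cx (D k) - (x + d)) + d) by ring.
    replace (cy (D k) - y) with ((cy (D k) - (h - (r + e))) + 0) by (unfold h; ring).
    replace (rad (D k) + r + 2 * e) with (rad (D k) + (r + e) + e) by ring.
    apply norm_triangle; try lra. nra. }
  apply apex_exists with (x + d) h; auto.
  - intros k HkV Hku Hkv Hkh. specialize (Hfar k HkV Hku Hkv).
    rewrite touch_wdist in Hfar by auto.
    pose proof (Hnear u ltac:(auto)). pose proof (Hnear v ltac:(auto)). lra.
  - intros k HkV Hkh Hkx.
    assert (Hku : k <> u) by (intros ->; lra). assert (Hkv : k <> v) by (intros ->; lra).
    apply (Hfar k HkV Hku Hkv). rewrite Hkx.
    replace (cy (D k) - (h - (r + e))) with (rad (D k) + (r + e)).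
    + nra.
    + rewrite <- Hkh. unfold bottom. ring.
Qed.

Lemma finite_choice {A B : Type} (d : B) (P : A -> B -> Prop) (l : list A) :
  (forall a b : A, {a = b} + {a <> b}) ->
  (forall a, In a l -> exists b, P a b) -> exists f, forall a, In a l -> P a (f a).
Proof.
  intros dec. induction l as [|a l IH]; intros H.
  - exists (fun _ => d). intros a [].
  - destruct IH as (f & Hf); [intros; apply H; now right|].
    destruct (H a (or_introl eq_refl)) as (b & Hb).
    exists (fun x => if dec x a then b else f x). intros x Hx.
    destruct (dec x a) as [->|Hn]; [auto|]. apply Hf. destruct Hx; congruence || auto.
Qed.

Lemma exact_pairs_sparse (D : nat -> pdisc) (V : list nat) (E : list (nat * nat)) :
  (forall k, In k V -> 0 < rad (D k)) ->
  (forall k l, In k V -> In l V -> k <> l -> ~ nested (D k) (D l)) ->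
  NoDup E ->
  (forall e, In e E -> (fst e < snd e)%nat /\ In (fst e) V /\ In (snd e) V /\
     exact_pair D V (fst e) (snd e)) ->
  (length E <= 4 * length V)%nat.
Proof.
  intros Hrad Hnest Hnd HE.
  assert (Hsep : forall k l, In k V -> In l V -> k <> l ->
    separated (fun k => cx (D k)) (bottom D) (fun k => 2 * rad (D k)) k l).
  { intros. apply separated_of_not_nested; auto. }
  destruct (finite_choice (0, 0) (fun e q => apex V (fun k => cx (D k)) (bottom D)
    (fun k => 2 * rad (D k)) (fst e) (snd e) (fst q) (snd q)) E pair_eq_dec) as (q & Hq).
  { intros e He. destruct (HE e He) as (H1 & H2 & H3 & H4).
    destruct (exact_pair_apex D V (fst e) (snd e)) as (x & h & A); auto; [lia|].
    exists (x, h). exact A. }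
  apply (cap_system_sparse V E (fun k => cx (D k)) (bottom D)
    (fun e => fst (q e)) (fun e => snd (q e))); [|auto].
  apply apexes_cap_system with (fun k => 2 * rad (D k)); [auto|].
  intros e He. destruct (HE e He) as (H1 & H2 & H3 & _). auto.
Qed.

Lemma exact_pair_sym D V u v : exact_pair D V u v -> exact_pair D V v u.
Proof.
  intros (B & HB & H). exists B. split; [auto|]. intros k Hk. rewrite (H k Hk). tauto.
Qed.

(** If [D j] is nested in [D i], every disc meeting [D j] meets [D i], so [i] is the only possible
    partner of [j]. Without nesting, nine partners for each member would give [9 * length V] ordered
    pairs, against at most twice [4 * length V]. *)
Lemma exact_pair_low_degree (D : nat -> pdisc) (V : list nat) :
  (forall k, In k V -> 0 < rad (D k)) -> NoDup V -> V <> [] ->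
  exists v N, In v V /\ (length N <= 8)%nat /\
    forall u, In u V -> u <> v -> exact_pair D V u v -> In u N.
Proof.
  intros Hrad Hnd Hne.
  destruct (classic (exists j i, In j V /\ In i V /\ j <> i /\ nested (D j) (D i)))
    as [(j & i & Hj & Hi & Hji & Hnest)|Hno].
  { exists j, [i]. split; [auto|split; [simpl; lia|]].
    intros u Hu Huj (B & HB & HBV). left.
    assert (Hi' : i = u \/ i = j); [|destruct Hi'; congruence].
    apply HBV; [auto|]. apply nested_meets with (D j); auto. apply HBV; auto. }
  assert (Hnest : forall k l, In k V -> In l V -> k <> l -> ~ nested (D k) (D l)).
  { intros k l Hk Hl Hkl Hn. apply Hno. exists k, l. auto. }
  apply NNPP. intros Hcon.
  assert (Hdeg : forall v, In v V -> exists N, NoDup N /\ (9 <= length N)%nat /\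
    forall u, In u N -> In u V /\ u <> v /\ exact_pair D V u v).
  { intros v Hv.
    destruct (exists_filter (fun u => u <> v /\ exact_pair D V u v) V Hnd) as (N & HN & HinN).
    exists N. split; [auto|split].
    - apply Nat.nlt_ge. intros Hlt. apply Hcon. exists v, N. split; [auto|split; [lia|]].
      intros u Hu Huv Hex. apply HinN. auto.
    - intros u Hu. apply HinN in Hu. tauto. }
  assert (Hord : forall l, NoDup l -> incl l V -> exists O : list (nat * nat), NoDup O /\
    (9 * length l <= length O)%nat /\
    forall p, In p O -> In (fst p) l /\ In (snd p) V /\ snd p <> fst p /\
      exact_pair D V (snd p) (fst p)).
  { induction l as [|v l IH]; intros Hl Hi.
    - exists []. simpl. repeat split; try constructor; tauto.
    - inversion Hl as [|? ? Hv Hl']; subst.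
      destruct IH as (O & HO & HlO & HinO); [auto|intros x Hx; apply Hi; now right|].
      destruct (Hdeg v) as (N & HN & HlN & HinN); [apply Hi; now left|].
      exists (map (pair v) N ++ O). split; [|split].
      + apply NoDup_app; [apply FinFun.Injective_map_NoDup; [|auto]|auto|].
        * intros a b Hab. congruence.
        * intros p Hp HpO. apply in_map_iff in Hp as (u & <- & _).
          apply HinO in HpO. simpl in HpO. tauto.
      + rewrite length_app, length_map. simpl. lia.
      + intros p Hp. apply in_app_or in Hp as [Hp|Hp].
        * apply in_map_iff in Hp as (u & <- & Hu). simpl. apply HinN in Hu. tauto.
        * apply HinO in Hp. simpl. tauto. }
  destruct (Hord V Hnd (incl_refl V)) as (O & HO & HlO & HinO).
  destruct (exists_filter (fun p => (fst p < snd p)%nat /\ exact_pair D V (fst p) (snd p)) (list_prod V V))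
    as (E & HE & HinE).
  { clear - Hnd. assert (K : forall l : list nat, NoDup l -> NoDup (list_prod l V)).
    { induction l as [|a l IH]; intros Hl; [constructor|].
      inversion Hl as [|? ? Ha Hl']; subst.
      change (NoDup (map (fun y => (a, y)) V ++ list_prod l V)).
      apply NoDup_app; [apply FinFun.Injective_map_NoDup; [|auto]|auto|].
      - intros x y Hxy. congruence.
      - intros [x y] Hp HpO. apply in_map_iff in Hp as (z & Hz & _).
        apply in_prod_iff in HpO. inversion Hz; subst. tauto. }
    auto. }
  assert (Hsp : (length E <= 4 * length V)%nat).
  { apply (exact_pairs_sparse D); auto. intros [a b] He. apply HinE in He as [H1 H2].
    apply in_prod_iff in H1. simpl in *. tauto. }
  assert (Hincl : incl O (E ++ map (fun p => (snd p, fst p)) E)).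
  { intros [a b] Hp. apply HinO in Hp as (H1 & H2 & H3 & H4). simpl in *.
    apply in_or_app. destruct (Nat.lt_total a b) as [Hlt|[Heq|Hgt]]; [left|congruence|right].
    - apply HinE. rewrite in_prod_iff. simpl. auto using exact_pair_sym.
    - apply in_map_iff. exists (b, a). split; [auto|].
      apply HinE. rewrite in_prod_iff. simpl. auto. }
  apply NoDup_incl_length in Hincl; [|auto].
  rewrite length_app, length_map in Hincl.
  destruct V; [tauto|]. simpl length in *. lia.
Qed.

(** * List colorings of discs *)

Definition disc_traces (D : nat -> pdisc) (e : nat -> Prop) : Prop :=
  exists B, 0 < rad B /\ e = (fun i => meets (D i) B).

Lemma disc_proper_coloring (D : nat -> pdisc) (V : list nat) :
  (forall k, In k V -> 0 < rad (D k)) -> NoDup V ->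
  exists chi, (forall v, In v V -> (chi v < 9)%nat) /\ proper_on (disc_traces D) V chi.
Proof.
  intros Hrad Hnd.
  apply (proper_coloring_of_degenerate (disc_traces D) V 8); auto using incl_refl.
  intros S HS HSV Hne.
  destruct (exact_pair_low_degree D S) as (v & N & Hv & HN & H); auto.
  exists v, N. split; [auto|split; [auto|]].
  intros u e Hu Huv (B & HB & ->) Hex. apply H; auto. exists B. auto.
Qed.

(** The constant is [18 = 2 * 9]: a list of length [a >= 18 * ln n] has weight [(1 - 1/9) ^ a <= exp
    (- a / 9) <= n ^ (-2)], so the total weight is at most [1 / n < 1]. *)
Lemma upper_bound (n : nat) (D : nat -> pdisc) (L : nat -> list nat) :
  (2 <= n)%nat -> (forall i, (i < n)%nat -> 0 < rad (D i)) ->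
  (forall i, (i < n)%nat -> NoDup (L i) /\ 18 * ln (INR n) <= INR (length (L i))) ->
  exists col : nat -> nat,
    (forall i, (i < n)%nat -> In (col i) (L i)) /\ conflict_free n D col.
Proof.
  intros Hn Hrad HL. set (V := seq 0 n).
  assert (HV : forall i, In i V <-> (i < n)%nat) by (intros i; unfold V; rewrite in_seq; lia).
  assert (HnR : 2 <= INR n) by (apply le_INR in Hn; simpl in Hn; lra).
  set (cs := nodup Nat.eq_dec (flat_map L V)).
  destruct (conflict_free_list_coloring (disc_traces D) L V 9) with (cs := cs) (S := V)
    as (col & Hcol & HCF); auto using incl_refl.
  - lia.
  - intros S HS HSV. apply disc_proper_coloring; [|auto]. intros k Hk. apply Hrad, HV, HSV, Hk.
  - apply NoDup_nodup.
  - apply seq_NoDup.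
  - apply Rle_lt_trans with (Rsum (fun _ => exp (- 2 * ln (INR n))) V).
    + apply Rsum_le. intros v Hv. destruct (HL v) as [HLnd HLlen]; [now apply HV|].
      assert (Hav : (length (L v) <= available L cs v)%nat).
      { apply NoDup_incl_length; [auto|]. intros c Hc. apply filter_In. split.
        - apply nodup_In, in_flat_map. eauto.
        - destruct (in_dec Nat.eq_dec c (L v)); auto. }
      apply le_INR in Hav. set (a := available L cs v) in *.
      replace (1 - / INR 9) with (1 + - (1 / 9)) by (simpl; lra).
      apply Rle_trans with (exp (- (1 / 9)) ^ a).
      * apply pow_incr. split; [lra|apply exp_ineq1_le].
      * rewrite <- Rpower_pow by apply exp_pos. unfold Rpower. rewrite ln_exp.
        assert (Hle : INR a * - (1 / 9) <= - 2 * ln (INR n)) by lra.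
        destruct Hle as [Hlt| ->]; [now apply Rlt_le, exp_increasing|lra].
    + rewrite Rsum_const. unfold V. rewrite length_seq.
      replace (- 2 * ln (INR n)) with (- ln (INR n) + - ln (INR n)) by ring.
      rewrite exp_plus, exp_Ropp, exp_ln by lra.
      rewrite <- Rmult_assoc, Rinv_r, Rmult_1_l by lra.
      apply Rle_lt_trans with (/ 2); [apply Rinv_le_contravar; lra|lra].
  - exists col. split; [intros i Hi; now apply Hcol, HV|].
    intros B HB (i & Hi & Hm).
    destruct (HCF (fun i => meets (D i) B)) as (v & Hv & Hmv & Hu).
    + exists B. auto.
    + exists i. rewrite HV. auto.
    + exists v. split; [now apply HV|split; [auto|]].
      intros j Hj Hjv Hmj. apply Hu; auto. now apply HV.
Qed.

(** * The lower bound *)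

(** Removing a position whose color is unique in the whole interval leaves a side with at least
    [2 ^ k] points of [2 ^ (k + 1)], on which that color no longer occurs. *)
Lemma interval_unique_color_bound (col : nat -> nat) (k : nat) : forall (cs : list nat) (a b : nat),
  (length cs <= k)%nat -> (2 ^ k <= b - a)%nat ->
  (forall i, (a <= i < b)%nat -> In (col i) cs) ->
  ~ (forall x y, (a <= x)%nat -> (x < y)%nat -> (y <= b)%nat ->
      exists i, (x <= i < y)%nat /\
        forall j, (x <= j < y)%nat -> j <> i -> col j <> col i).
Proof.
  induction k as [|k IH]; intros cs a b Hcs Hab Hcol Huniq.
  - destruct cs; [|simpl in Hcs; lia]. simpl in Hab. apply (Hcol a). lia.
  - rewrite Nat.pow_succ_r' in Hab.
    assert (Hp : (2 ^ k <> 0)%nat) by now apply Nat.pow_nonzero.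
    destruct (Huniq a b) as (i & Hi & Hiu); try lia.
    assert (Hlen : (length (remove Nat.eq_dec (col i) cs) <= k)%nat).
    { pose proof (remove_length_lt Nat.eq_dec cs (col i) (Hcol i Hi)). lia. }
    assert (Hcol' : forall j, (a <= j < b)%nat -> j <> i -> In (col j) (remove Nat.eq_dec (col i) cs)).
    { intros j Hj Hji. apply in_in_remove; auto. }
    destruct (Nat.le_gt_cases (2 ^ k) (i - a)) as [Hl|Hl].
    + apply (IH _ a i Hlen Hl).
      * intros j Hj. apply Hcol'; lia.
      * intros x y Hx Hxy Hy. apply Huniq; lia.
    + apply (IH _ (i + 1) b Hlen)%nat.
      * lia.
      * intros j Hj. apply Hcol'; lia.
      * intros x y Hx Hxy Hy. apply Huniq; lia.
Qed.

Definition row_disc (i : nat) : pdisc := mkPDisc (3 * INR i) 0 1.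

Lemma row_disc_interval (x y : nat) : (x < y)%nat ->
  exists B, 0 < rad B /\ forall i, meets (row_disc i) B <-> (x <= i < y)%nat.
Proof.
  intros Hxy. apply Nat.lt_le_pred in Hxy as Hxy'.
  set (z := Nat.pred y) in *. assert (Ey : y = S z) by (unfold z; lia).
  apply le_INR in Hxy' as HR.
  (* This disc meets the members whose centers are within [3/2] of the segment from the center of
     [x] to that of [z]; consecutive centers are [3] apart. *)
  exists (mkPDisc (3 * (INR x + INR z) / 2) 0 (3 * (INR z - INR x) / 2 + 1 / 2)).
  split; [simpl; lra|]. intros i. rewrite meets_iff by (simpl; lra). simpl cx. simpl cy. simpl rad.
  split.
  - intros H.
    assert (Hx : (x <= i)%nat).
    { apply Nat.nlt_ge. intros Hlt. apply le_INR in Hlt. rewrite S_INR in Hlt. nra. }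
    assert (Hz : (i <= z)%nat).
    { apply Nat.nlt_ge. intros Hlt. apply le_INR in Hlt. rewrite S_INR in Hlt. nra. }
    lia.
  - intros [H1 H2]. assert (H3 : (i <= z)%nat) by lia.
    apply le_INR in H1, H3.
    assert (3 * INR i - 3 * (INR x + INR z) / 2 <= 1 + (3 * (INR z - INR x) / 2 + 1 / 2)) by lra.
    assert (- (1 + (3 * (INR z - INR x) / 2 + 1 / 2)) <= 3 * INR i - 3 * (INR x + INR z) / 2) by lra.
    nra.
Qed.

(** With [k = log2 n] one has [n < 2 ^ (k + 1) <= exp (k + 1)], and [k + 1 <= 2 * k] because
    [k >= 1]. *)
Lemma half_ln_le_log2 (n : nat) : (2 <= n)%nat -> 1 / 2 * ln (INR n) <= INR (Nat.log2 n).
Proof.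
  intros Hn. set (k := Nat.log2 n).
  assert (Hk : (1 <= k)%nat) by (apply Nat.log2_le_pow2; simpl; lia).
  destruct (Nat.log2_spec n ltac:(lia)) as [_ Hlt]. fold k in Hlt.
  assert (H2 : INR n <= exp (INR (S k))).
  { apply lt_INR in Hlt. rewrite pow_INR in Hlt. simpl (INR 2) in Hlt.
    replace (INR (S k)) with (INR (S k) * ln (exp 1)) by (rewrite ln_exp; ring).
    fold (Rpower (exp 1) (INR (S k))). rewrite Rpower_pow by apply exp_pos.
    apply Rlt_le, Rlt_le_trans with (1 := Hlt). apply pow_incr.
    pose proof (exp_ineq1_le 1). lra. }
  assert (H0 : 0 < INR n) by (apply lt_0_INR; lia).
  assert (H3 : ln (INR n) <= INR (S k)).
  { rewrite <- (ln_exp (INR (S k))). destruct H2 as [H2| ->]; [|lra].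
    now apply Rlt_le, ln_increasing. }
  rewrite S_INR in H3. apply le_INR in Hk. simpl in Hk. lra.
Qed.

Lemma lower_bound (n : nat) (col : nat -> nat) : (2 <= n)%nat ->
  (forall i, (i < n)%nat -> In (col i) (seq 0 (Nat.log2 n))) ->
  ~ conflict_free n row_disc col.
Proof.
  intros Hn Hcol HCF.
  apply (interval_unique_color_bound col (Nat.log2 n) (seq 0 (Nat.log2 n)) 0 n).
  - rewrite length_seq. lia.
  - rewrite Nat.sub_0_r. apply Nat.log2_spec. lia.
  - intros i Hi. apply Hcol. lia.
  - intros x y _ Hxy Hy. destruct (row_disc_interval x y Hxy) as (B & HB & HBi).
    destruct (HCF B HB) as (i & Hi & Hm & Hu).
    + exists x. split; [lia|]. apply HBi. lia.
    + exists i. split; [now apply HBi|]. intros j Hj Hji. apply Hu; [lia|auto|now apply HBi].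
Qed.

Theorem theorem1p5 :
  (* upper bound *)
  (exists C : R,
    forall (n : nat), (2 <= n)%nat ->
    forall D : nat -> pdisc, (forall i, (i < n)%nat -> 0 < rad (D i)) ->
    forall L : nat -> list nat,
      (forall i, (i < n)%nat -> NoDup (L i) /\ C * ln (INR n) <= INR (length (L i))) ->
      exists col : nat -> nat,
        (forall i, (i < n)%nat -> In (col i) (L i)) /\ conflict_free n D col)
  /\
  (* asymptotic tightness of the O(log n) bound *)
  (exists c : R, 0 < c /\
    forall (n : nat), (2 <= n)%nat ->
    exists (D : nat -> pdisc) (L : nat -> list nat),
      (forall i, (i < n)%nat -> 0 < rad (D i)) /\
      (forall i, (i < n)%nat -> NoDup (L i) /\ (1 <= length (L i))%nat /\
                               c * ln (INR n) <= INR (length (L i))) /\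
      forall col : nat -> nat,
        (forall i, (i < n)%nat -> In (col i) (L i)) -> ~ conflict_free n D col).
Proof.
  split.
  - exists 18. intros n Hn D Hrad L HL. now apply upper_bound.
  - exists (1 / 2). split; [lra|]. intros n Hn.
    exists row_disc, (fun _ => seq 0 (Nat.log2 n)).
    split; [intros; simpl; lra|]. split.
    + intros i _. rewrite length_seq. split; [apply seq_NoDup|split].
      * apply Nat.log2_le_pow2; simpl; lia.
      * now apply half_ln_le_log2.
    + intros col Hcol. now apply lower_bound.
Qed.
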